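(* (Comparison principle) Let $N\ge2$ and let $\Omega\subset\mathbb{R}^N$ be a bounded domain. Suppose that $-Q_Nu\le-Q_Nv$ in $\Omega$ and $u\le v$ on $\partial\Omega$. Then $u\le v$ a.e. in $\Omega$.
   Context: Let $N\ge 2$ and let $F:\mathbb{R}^N\to[0,\infty)$ be a fixed convex function of class $C^2(\mathbb{R}^N\setminus\{0\})$ with $F(t\xi)=|t|F(\xi)$ for all $t\in\mathbb{R}$, $\xi\in\mathbb{R}^N$, with $F(\xi)>0$ for $\xi\ne0$, and with $\mathrm{Hess}(F^2)$ positive definite in $\mathbb{R}^N\setminus\{0\}$. Write $F_{\xi_i}=\partial F/\partial\xi_i$ and $F_\xi=(F_{\xi_1},\dots,F_{\xi_N})$. The $N$-anisotropic Laplacian is $$Q_N u=\sum_{i=1}^N\frac{\partial}{\partial x_i}\bigl(F^{N-1}(\nabla u)F_{\xi_i}(\nabla u)\bigr),$$ where $F^{N-1}F_\xi$ is taken to be $0$ at the origin. The inequality $-Q_Nu\le-Q_Nv$ is understood in the usual weak sense, $\int_\Omega \langle F^{N-1}(\nabla u)F_\xi(\nabla u)-F^{N-1}(\nabla v)F_\xi(\nabla v),\nabla\varphi\rangle\,dx\le0$ for nonnegative test functions $\varphi$ vanishing on $\partial\Omega$, and boundary inequalities are understood in the Sobolev sense. *)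

(* Defs.v *)
From HB Require Import structures.
From mathcomp Require Import all_boot all_order all_algebra.
From mathcomp Require Import all_classical all_reals all_analysis.
From mathcomp Require Import measurable_realfun.

Set Implicit Arguments.
Unset Strict Implicit.
Unset Printing Implicit Defensive.

Import Order.TTheory GRing.Theory Num.Theory.
Import numFieldNormedType.Exports.

Local Open Scope classical_set_scope.
Local Open Scope ring_scope.

(* The sigma-algebra on row vectors generated by the coordinate maps; for
   T = R this is the Borel sigma-algebra of R^n. *)
Section measurable_rV.
Context {d} {T : sigmaRingType d}.
Variable n : nat.

Definition rV_coord (i : 'I_n) (x : 'rV[T]_n) : T := x ord0 i.

Let rV_set0 : g_sigma_preimage rV_coord set0.
Proof. exact: sigma_algebra0. Qed.

Let rV_setC A : g_sigma_preimage rV_coord A -> g_sigma_preimage rV_coord (~` A).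
Proof. exact: sigma_algebraC. Qed.

Let rV_bigcup (F : _^nat) : (forall i, g_sigma_preimage rV_coord (F i)) ->
  g_sigma_preimage rV_coord (\bigcup_i (F i)).
Proof. exact: sigma_algebra_bigcup. Qed.

HB.instance Definition _ := @isMeasurable.Build (measure_tuple_display d)
  'rV[T]_n (g_sigma_preimage rV_coord) rV_set0 rV_setC rV_bigcup.

Lemma measurable_rV_coord i : measurable_fun [set: 'rV[T]_n] (rV_coord i).
Proof.
move=> _ Y mY; rewrite setTI; apply: sub_sigma_algebra => /=.
rewrite -bigcup_seq/=; exists i => /=; first by rewrite mem_index_enum.
by exists Y => //; rewrite setTI.
Qed.

End measurable_rV.

Lemma measurable_fun_rVP d1 d2 (T1 : measurableType d1) (T2 : measurableType d2)
    n (f : T1 -> 'rV[T2]_n) :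
  measurable_fun [set: T1] f <->
  forall i, measurable_fun [set: T1] (rV_coord i \o f).
Proof.
split=> [mf i|mf].
  by apply: measurableT_comp mf; exact: measurable_rV_coord.
suff : g_sigma_preimage (fun i => rV_coord i \o f) `<=` measurable.
  rewrite g_sigma_preimage_comp => h _ A mA.
  by apply: h; exists A.
apply: smallest_sub; first exact: sigma_algebra_measurable.
case: n => [|n] in f mf *; first by rewrite big_ord0.
rewrite -bigcup_mkord_ord; apply: bigcup_sub => i Ii.
by move=> A [B mB <-]; exact: mf.
Qed.

Section rV_cons.
Context d (T : measurableType d) (n : nat).

Definition rV_cons (p : T * 'rV[T]_n) : 'rV[T]_n.+1 :=
  \row_i oapp (p.2 ord0) p.1 (unlift ord0 i).

Definition rV_uncons (x : 'rV[T]_n.+1) : T * 'rV[T]_n :=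
  (x ord0 ord0, \row_i x ord0 (lift ord0 i)).

Lemma rV_consK : cancel rV_cons rV_uncons.
Proof.
move=> [a x]; congr pair; first by rewrite mxE unlift_none.
by apply/rowP => i; rewrite !mxE liftK.
Qed.

Lemma measurable_rV_cons : measurable_fun [set: T * 'rV[T]_n] rV_cons.
Proof.
apply/measurable_fun_rVP => i; case: (unliftP ord0 i) => [j ->|->].
  rewrite (_ : _ \o _ = rV_coord j \o snd).
    by apply: measurableT_comp => //; exact: measurable_rV_coord.
  by apply/funext => p; rewrite /rV_coord /= mxE liftK.
rewrite (_ : _ \o _ = fst)//.
by apply/funext => p; rewrite /rV_coord /= mxE unlift_none.
Qed.

Lemma measurable_rV_uncons : measurable_fun [set: 'rV[T]_n.+1] rV_uncons.
Proof.
apply: measurable_fun_pair; first exact: measurable_rV_coord.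
apply/measurable_fun_rVP => i.
rewrite (_ : _ \o _ = rV_coord (lift ord0 i)); first exact: measurable_rV_coord.
by apply/funext => x; rewrite /rV_coord /= mxE.
Qed.

End rV_cons.

Section lebesgue_rV.
Context {R : realType}.

(* R^n.+1 is identified with R x R^n through rV_cons. *)
Section step.
Context {n : nat} (m : {sigma_finite_measure set 'rV[R]_n -> \bar R}).

Definition lebesgue_rVS : set 'rV[R]_n.+1 -> \bar R :=
  pushforward (@lebesgue_measure R \x m)%E (@rV_cons _ R n).

Let push : {measure set 'rV[R]_n.+1 -> \bar R} :=
  measure_function_pushforward__canonical__measure_function_Measure
    (@lebesgue_measure R \x m)%E (@measurable_rV_cons _ R n).

HB.instance Definition _ := isMeasure.Build _ _ _ lebesgue_rVS
  (measure0 push) (measure_ge0 push) (@measure_semi_sigma_additive _ _ _ push).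

Let sigma_finiteS : sigma_finite setT lebesgue_rVS.
Proof.
have /sigma_finiteP[F [TF ndF Foo]] := sigma_finiteT (@lebesgue_measure R).
have /sigma_finiteP[G [TG ndG Goo]] := sigma_finiteT m.
exists (fun k => (@rV_uncons _ R n) @^-1` (F k `*` G k)).
  rewrite -preimage_bigcup -[LHS](preimage_setT (@rV_uncons _ R n)).
  congr (_ @^-1` _); rewrite -setXTT TF TG predeqE => -[x y]; split.
    move=> [/= [k _ Fkx] [l _ Gly]]; exists (maxn k l) => //; split.
    - by move: x Fkx; exact/subsetPset/ndF/leq_maxl.
    - by move: y Gly; exact/subsetPset/ndG/leq_maxr.
  by move=> [k _ []/= ? ?]; split; exists k.
move=> k; have [mF Fk] := Foo k; have [mG Gk] := Goo k; split.
  rewrite -[X in measurable X]setTI; apply: measurable_rV_uncons => //.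
  exact: measurableX.
rewrite /lebesgue_rVS /pushforward -comp_preimage.
rewrite (_ : _ \o _ = id); last by apply/funext => x; exact: rV_consK.
rewrite preimage_id.
rewrite [ltLHS](@product_measure1E _ _ _ _ _ (@lebesgue_measure R) m)//.
by rewrite lte_mul_pinfty// ge0_fin_numE.
Qed.

HB.instance Definition _ :=
  Measure_isSigmaFinite.Build _ _ _ lebesgue_rVS sigma_finiteS.

End step.

Fixpoint lebesgue_rV (n : nat) : {sigma_finite_measure set 'rV[R]_n -> \bar R} :=
  match n with
  | 0 => \d_(0 : 'rV[R]_0)
  | n'.+1 => lebesgue_rVS (lebesgue_rV n')
  end.

End lebesgue_rV.
Arguments lebesgue_rV : clear implicits.

Section smooth.
Context {R : realType} {n : nat}.
Implicit Types (f : 'rV[R]_n -> R) (U : set 'rV[R]_n) (x : 'rV[R]_n).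

Definition partial (i : 'I_n) f x : R := 'D_(delta_mx ord0 i) f x.

Definition gradient f x : 'rV[R]_n := \row_i partial i f x.

Definition hessian f x : 'M[R]_n := \matrix_(i, j) partial i (partial j f) x.

(* f is of class C^k on U, for U open: the iterated partial derivatives exist
   and are continuous at the points of U *)
Fixpoint Ck_on (k : nat) U f : Prop :=
  (forall x, U x -> {for x, continuous f}) /\
  match k with
  | 0 => True
  | k'.+1 => forall i, (forall x, U x -> derivable f x (delta_mx ord0 i)) /\
                       Ck_on k' U (partial i f)
  end.

(* C_c^oo(U): smooth on R^n, with compact support included in U *)
Definition Cc_smooth U f : Prop :=
  [/\ forall k, Ck_on k setT f,
      compact (closure [set x | f x != 0]) &
      closure [set x | f x != 0] `<=` U].

End smooth.

Definition positive_definite {R : realType} {n : nat} (A : 'M[R]_n) : Prop :=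
  forall v : 'rV[R]_n, v != 0 -> 0 < (v *m A *m v^T) ord0 ord0.

Definition dot {R : realType} {n : nat} (x y : 'rV[R]_n) : R :=
  (x *m y^T) ord0 ord0.

Definition domain {R : realType} {n : nat} (U : set 'rV[R]_n) : Prop :=
  [/\ open U, connected U & U !=set0].

(* Sobolev functions are given as a pair of a representative u and a
   representative Du of its weak gradient; only the values on U matter. *)
Section sobolev.
Context {R : realType} {n : nat}.
Implicit Types (U : set 'rV[R]_n) (u : 'rV[R]_n -> R) (Du : 'rV[R]_n -> 'rV[R]_n).
Local Notation mu := (lebesgue_rV R n).

Definition in_Lp (p : nat) U u : Prop :=
  measurable_fun U u /\ (\int[mu]_(x in U) (`|u x| ^+ p)%:E < +oo)%E.

Definition weak_gradient U u Du : Prop :=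
  forall phi i, Cc_smooth U phi ->
    \int[mu]_(x in U) (u x * partial i phi x) =
    - \int[mu]_(x in U) (Du x ord0 i * phi x).

Definition W1p (p : nat) U u Du : Prop :=
  [/\ in_Lp p U u, forall i, in_Lp p U (fun x => Du x ord0 i) &
      weak_gradient U u Du].

(* W_0^{1,p}(U) is the closure of C_c^oo(U) in W^{1,p}(U) *)
Definition W1p0 (p : nat) U u Du : Prop :=
  W1p p U u Du /\
  exists phi : nat -> 'rV[R]_n -> R,
    [/\ forall k, Cc_smooth U (phi k),
        (\int[mu]_(x in U) (`|phi k x - u x| ^+ p)%:E)%E @[k --> \oo] --> 0%E &
        forall i, (\int[mu]_(x in U) (`|partial i (phi k) x - Du x ord0 i| ^+ p)%:E)%E
          @[k --> \oo] --> 0%E].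

(* u <= v on the boundary of U in the Sobolev sense: (u - v)^+ is in
   W_0^{1,p}(U) *)
Definition le_boundary (p : nat) U u v : Prop :=
  exists Dw, W1p0 p U (fun x => Num.max (u x - v x) 0) Dw.

End sobolev.

Section anisotropic.
Context {R : realType} {N : nat} (F : 'rV[R]_N -> R).

(* the field F^{N-1} F_xi, extended by 0 at the origin *)
Definition QN_flux (xi : 'rV[R]_N) : 'rV[R]_N :=
  if xi == 0 then 0 else F xi ^+ N.-1 *: gradient F xi.

(* - Q_N u <= - Q_N v weakly in U, for functions u, v of W^{1,N}(U) with weak
   gradients Du, Dv *)
Definition le_opp_QN (U : set 'rV[R]_N) (Du Dv : 'rV[R]_N -> 'rV[R]_N) : Prop :=
  forall phi Dphi, W1p0 N U phi Dphi ->
    {ae lebesgue_rV R N, forall x, U x -> 0 <= phi x} ->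
    \int[lebesgue_rV R N]_(x in U)
      dot (QN_flux (Du x) - QN_flux (Dv x)) (Dphi x) <= 0.

End anisotropic.

(* Main.v *)
Require Import Defs.
From HB Require Import structures.
From mathcomp Require Import all_boot all_order all_algebra.
From mathcomp Require Import all_classical all_reals all_analysis.
From mathcomp Require Import measurable_realfun.
From mathcomp Require Import ring lra.

Set Implicit Arguments.
Unset Strict Implicit.
Unset Printing Implicit Defensive.

Import Order.TTheory GRing.Theory Num.Theory.
Import numFieldNormedType.Exports.

Local Open Scope classical_set_scope.
Local Open Scope ring_scope.

(* The function w = max(u - v, 0) is an admissible test function. Its given weak
   gradient Dw vanishes a.e. on {w = 0} and equals Du - Dv a.e. on {w > 0}: both
   statements are the fact that a nonnegative function g with weak partial
   derivative f satisfies f = 0 a.e. on {g = 0}, applied to g = w and to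
   g = w - (u - v). That fact is one-dimensional: on almost every line g agrees
   a.e. with a primitive of f, and at a zero of g this primitive has a minimum.

   Testing with w, the integrand <a(Du) - a(Dv), Dw>, where a = F^{N-1} F_xi, is
   therefore nonnegative, so it vanishes a.e., and strict monotonicity of a
   gives Dw = 0. By the Poincare inequality w = 0. Strict monotonicity follows
   from <F_xi(xi), eta> <= F(eta) (convexity and homogeneity): equality forces F
   to be constant on the segment [xi, eta], against Hess(F^2) > 0. *)

(** * Boxes and the Lebesgue measure of R^n *)

(** The boundary hypothesis supplies some weak gradient [Dw] of w, tied to [Du] and [Dv] only
    through integrals against C_c^oo functions, so every pointwise fact about it must be extracted
    from chosen tests. These tests are products of one-variable profiles: a trapezoid in direction
    i, whose derivative is a step function of integral zero, times indicators of intervals in the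
    other directions, all reached as bounded limits of smooth profiles built from exp(-1/t). The
    indicators localize to almost every line, because boxes form a pi-system; the break points of
    the trapezoids are rational, so that the exceptional lines form a countable union of null sets.

    The Poincare inequality is used in L^1 and in a single direction; L^N convergence is turned into
    L^1 smallness by an elementary inequality on a set of finite measure.

    In strict monotonicity, the case F(xi) <> F(eta) is settled by the strict growth of s^{N-1}; the
    Hessian enters when the two values agree. *)

Section boxes.
Context {R : realType}.

Definition rV_box {n : nat} (p q : 'rV[R]_n) : set 'rV[R]_n :=
  [set x | forall i, x ord0 i \in `]p ord0 i, q ord0 i]].

(** For [i = ord0] this is [rV_cons]; a general i makes the lines parallel to any chosen axis
    available to Fubini. *)
Definition rV_ins {n : nat} (i : 'I_n.+1) (z : R * 'rV[R]_n) : 'rV[R]_n.+1 :=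
  \row_k oapp (z.2 ord0) z.1 (unlift i k).

Definition rV_del {n : nat} (i : 'I_n.+1) (x : 'rV[R]_n.+1) : 'rV[R]_n :=
  \row_k x ord0 (lift i k).

Lemma rV_ins_i n (i : 'I_n.+1) z : rV_ins i z ord0 i = z.1.
Proof. by rewrite mxE unlift_none. Qed.

Lemma rV_ins_lift n (i : 'I_n.+1) z k : rV_ins i z ord0 (lift i k) = z.2 ord0 k.
Proof. by rewrite mxE liftK. Qed.

Lemma measurable_rV_ins n (i : 'I_n.+1) : measurable_fun [set: R * 'rV[R]_n] (rV_ins i).
Proof.
apply/measurable_fun_rVP => k; case: (unliftP i k) => [j ->|->].
  rewrite (_ : _ \o _ = rV_coord j \o snd).
    by apply: measurableT_comp => //; exact: measurable_rV_coord.
  by apply/funext => z; rewrite /= /rV_coord rV_ins_lift.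
rewrite (_ : _ \o _ = fst)//.
by apply/funext => z; rewrite /= /rV_coord rV_ins_i.
Qed.

Lemma measurable_rV_box n (p q : 'rV[R]_n) : measurable (rV_box p q).
Proof.
rewrite (_ : rV_box p q =
    \bigcap_(i in [set: 'I_n]) (@rV_coord _ R n i @^-1` `]p ord0 i, q ord0 i])).
  apply: fin_bigcap_measurable => // i _; rewrite -[X in measurable X]setTI.
  exact: measurable_rV_coord.
by apply/seteqP; split => x /= xpq i *; exact: xpq.
Qed.

Lemma rV_boxI n (p q p' q' : 'rV[R]_n) : rV_box p q `&` rV_box p' q' =
  rV_box (\row_i Num.max (p ord0 i) (p' ord0 i)) (\row_i Num.min (q ord0 i) (q' ord0 i)).
Proof.
apply/seteqP; split => [x [xp xp'] i|x H].
  move: (xp i) (xp' i); rewrite !in_itv/= !mxE gt_max le_min.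
  by move=> /andP[-> ->] /andP[-> ->].
by split => i; move: (H i); rewrite !in_itv/= !mxE gt_max le_min
  => /andP[/andP[? ?] /andP[? ?]]; apply/andP.
Qed.

Lemma rV_norm_coord n (x : 'rV[R]_n) i : `|x ord0 i| <= `|x|.
Proof.
rewrite [leRHS]/Num.norm/= mx_normrE.
exact: (le_trans _ (le_bigmax _ (fun ij => `|x ij.1 ij.2|) (ord0, i))).
Qed.

Lemma bigcup_rV_box n (i : 'I_n) (a : R) :
  \bigcup_k rV_box (\row_j (if j == i then a else - k%:R)) (\row_(j < n) k%:R)
  = rV_coord i @^-1` `]a, +oo[.
Proof.
apply/seteqP; split => [x [k _] /(_ i)|x]; rewrite /rV_coord /= !in_itv/= ?andbT.
  by rewrite !mxE eqxx => /andP[].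
move=> ax; exists (Num.truncn `|x|%R).+1 => // j; rewrite in_itv/= !mxE.
have : `|x ord0 j| < (Num.truncn `|x|%R).+1%:R.
  by rewrite (le_lt_trans (rV_norm_coord x j))// truncnS_gt.
rewrite ltr_norml => /andP[? ?]; apply/andP; split; last exact: ltW.
by case: ifPn => // /eqP ->.
Qed.

Definition rV_boxes {n : nat} : set (set 'rV[R]_n) :=
  [set A | exists p q, A = rV_box p q].

(** A half-space x_i > a is a countable union of boxes, so the coordinates, hence the identity, are
    measurable from the sigma-algebra generated by the boxes. *)
Lemma measurable_rV_boxesE n : @measurable _ 'rV[R]_n = <<s @rV_boxes n >>.
Proof.
rewrite eqEsubset; split => [A mA|]; last first.
  apply: smallest_sub; first exact: sigma_algebra_measurable.
  by move=> _ [p [q ->]]; exact: measurable_rV_box.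
suff : measurable_fun [set: g_sigma_algebraType (@rV_boxes n)] (@idfun 'rV[R]_n).
  by move=> /(_ measurableT A mA); rewrite setTI.
apply/measurable_fun_rVP => i.
apply: (measurability _ (RGenOInfty.measurableE R)) => _ [_ [a ->] <-].
rewrite setTI (_ : _ \o idfun = rV_coord i)// -bigcup_rV_box; apply: bigcup_measurable => k _.
by apply: sub_sigma_algebra; eexists; eexists; reflexivity.
Qed.

Lemma setI_closed_rV_boxes n : setI_closed (@rV_boxes n).
Proof.
by move=> _ _ [p [q ->]] [p' [q' ->]]; rewrite rV_boxI; eexists; eexists; reflexivity.
Qed.

Definition rV_cube n (k : nat) : set 'rV[R]_n := rV_box (const_mx (- k%:R)) (const_mx k%:R).

Lemma bigcup_rV_cube n : \bigcup_k @rV_cube n k = setT.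
Proof.
apply/seteqP; split => // x _; exists (Num.truncn `|x|%R).+1 => // j.
rewrite in_itv/= !mxE.
have : `|x ord0 j| < (Num.truncn `|x|%R).+1%:R.
  by rewrite (le_lt_trans (rV_norm_coord x j))// truncnS_gt.
by rewrite ltr_norml => /andP[-> /ltW ->].
Qed.

Lemma rV_ins_box n (i : 'I_n.+1) (p q : 'rV[R]_n.+1) :
  rV_ins i @^-1` rV_box p q =
  `]p ord0 i, q ord0 i] `*` rV_box (rV_del i p) (rV_del i q).
Proof.
apply/seteqP; split => [[t y] /= H|[t y] [/= Ht Hy] k].
  split => /=; first by have := H i; rewrite rV_ins_i.
  by move=> k; have := H (lift i k); rewrite rV_ins_lift !mxE.
case: (unliftP i k) => [j ->|->]; last by rewrite rV_ins_i.
by rewrite rV_ins_lift; have := Hy j; rewrite !mxE.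
Qed.

Lemma lebesgue_rV_box n (p q : 'rV[R]_n) : lebesgue_rV R n (rV_box p q) =
  (\prod_(i < n) lebesgue_measure `]p ord0 i, q ord0 i]%classic)%E.
Proof.
elim: n p q => [|n IH] p q.
  rewrite big_ord0 /= /dirac/= indicE mem_set//.
  by move=> [].
rewrite big_ord_recl.
(* Holds by conversion: [lebesgue_rV] at n+1 is the pushforward under [rV_cons], which unfolds to
   the same map as [rV_ins ord0]. *)
transitivity ((lebesgue_measure \x lebesgue_rV R n)%E (rV_ins ord0 @^-1` rV_box p q)).
  by [].
rewrite rV_ins_box product_measure1E//; last exact: measurable_rV_box.
congr (_ * _)%E; rewrite IH; apply: eq_bigr => i _.
by rewrite !mxE.
Qed.

Lemma lebesgue_rV_box_fin n (p q : 'rV[R]_n) : (lebesgue_rV R n (rV_box p q) < +oo)%E.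
Proof.
rewrite lebesgue_rV_box ltey; apply/negP => /eqP H.
suff : (\prod_(i < n) lebesgue_measure `]p ord0 i, q ord0 i]%classic)%E \is a fin_num.
  by rewrite H.
elim/big_ind: _ => [//|x y xf yf|i _]; first exact: fin_numM.
by rewrite lebesgue_measure_itv/=; case: ifP.
Qed.

(** The measure is built by splitting off coordinate 0, but its value on a box is a product of
    lengths, which is insensitive to the factor pulled out. Boxes are a pi-system and the cubes
    exhaust the space with finite measure, so the two measures coincide. *)
Lemma lebesgue_rV_ins n (i : 'I_n.+1) (A : set 'rV[R]_n.+1) : measurable A ->
  lebesgue_rV R n.+1 A = (lebesgue_measure \x lebesgue_rV R n)%E (rV_ins i @^-1` A).
Proof.
move=> mA.
apply: (measure_unique (@rV_boxes n.+1) (@rV_cube n.+1) _ _ _ _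
  (lebesgue_rV R n.+1) (measure_function_pushforward__canonical__measure_function_Measure
    (@lebesgue_measure R \x lebesgue_rV R n)%E (measurable_rV_ins i))) => //.
- exact: measurable_rV_boxesE.
- exact: setI_closed_rV_boxes.
- by move=> k; eexists; eexists; reflexivity.
- exact: bigcup_rV_cube.
- move=> _ [p [q ->]].
  transitivity ((lebesgue_measure \x lebesgue_rV R n)%E (rV_ins i @^-1` rV_box p q)); last by [].
  rewrite rV_ins_box product_measure1E//; last exact: measurable_rV_box.
  apply: (etrans (lebesgue_rV_box p q)).
  rewrite lebesgue_rV_box (bigD1_ord i)//=; congr (_ * _)%E.
  by apply: eq_bigr => j _; rewrite !mxE.
- move=> k; exact: lebesgue_rV_box_fin.
Qed.
End boxes.

(** * Open sets as countable unions of rational boxes, and measurability of continuous functions *)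

Section open_sets.
Context {R : realType} {n : nat}.
Implicit Types U : set 'rV[R]_n.

Definition rat_box (ck : 'rV[rat]_n * nat) : set 'rV[R]_n :=
  rV_box (\row_i (ratr (ck.1 ord0 i) - ck.2.+1%:R^-1))
         (\row_i (ratr (ck.1 ord0 i) + ck.2.+1%:R^-1)).

(** The index set is countable. A box has half-width 1/(k+1) while the ball required to lie in [U]
    has radius 2/(k+1): the slack leaves room for the supports of test functions around each box. *)
Lemma open_bigcup_rat_box U : open U ->
  U = \bigcup_(ck in [set ck : 'rV[rat]_n * nat |
        ball (map_mx ratr ck.1 : 'rV[R]_n) (2 / ck.2.+1%:R) `<=` U]) rat_box ck.
Proof.
move=> oU; apply/seteqP; split => [x Ux|x [[c k]] /= cU xck]; last first.
  have k0 : 0 < (k.+1%:R^-1 : R) by rewrite invr_gt0.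
  apply: cU; split; first by rewrite mulr_gt0.
  move=> i j; rewrite ord1 /ball/= !mxE.
  have := xck j; rewrite in_itv/= !mxE/=.
  by move: k0; set d := k.+1%:R^-1; set r := ratr _ => d0 /andP[? ?]; rewrite ltr_norml; lra.
have /nbhs_ballP[e /= e0 xeU] : nbhs x U by exact: open_nbhs_nbhs.
(* The centre will be within d of x and the ball has radius 2d, which makes 3d in total. *)
have [k ke] : exists k, 3 * k.+1%:R^-1 < e.
  exists (Num.truncn (3 / e)).
  have : 3 / e < (Num.truncn (3 / e)).+1%:R by exact: truncnS_gt.
  by rewrite ltr_pdivrMr// mulrC -ltr_pdivrMr.
have k0 : 0 < (k.+1%:R^-1 : R) by rewrite invr_gt0.
move: ke k0; set d : R := k.+1%:R^-1 => ke k0.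
have /choice[c xc] : forall i : 'I_n, exists q : rat, `|x ord0 i - ratr q| < d.
  move=> i; have /rat_in_itvoo[q] : x ord0 i < x ord0 i + d by rewrite ltrDl.
  by rewrite in_itv/= => /andP[? ?]; exists q; rewrite ltr_norml; lra.
exists (\row_i c i, k) => /=.
  apply: subset_trans xeU => y [_ yc]; split => // i j; rewrite ord1.
  have := yc ord0 j; have := xc j; rewrite /ball/= !mxE -/d !ltr_norml.
  by set r := ratr _ => /andP[? ?] /andP[? ?]; lra.
move=> i; have := xc i; rewrite in_itv/= !mxE -/d ltr_norml.
by set r := ratr _ => /andP[? ?]; lra.
Qed.

Lemma rV_open_measurable U : open U -> measurable U.
Proof.
move=> /open_bigcup_rat_box ->.
rewrite bigcup_mkcond; apply: countable_bigcupT_measurable.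
  exact: countableP.
by move=> ck; case: ifP => // _; exact: measurable_rV_box.
Qed.

Lemma rV_continuous_measurable U (f : 'rV[R]_n -> R) : open U ->
  (forall x, U x -> {for x, continuous f}) -> measurable_fun U f.
Proof.
move=> oU cf.
apply: (measurability _ (RGenOInfty.measurableE R)) => _ [_ [a ->] <-].
apply: rV_open_measurable; rewrite openE => x [Ux /= fxa]; rewrite /interior.
apply: filterI; first exact: open_nbhs_nbhs.
by apply: (cf x Ux); apply: open_nbhs_nbhs; split.
Qed.

End open_sets.

(** * Functions whose integrals over boxes vanish *)

Section box_integral.
Context {R : realType} {n : nat}.
Local Notation mu := (lebesgue_rV R n).
Local Open Scope ereal_scope.

(** Dynkin induction: the sets E whose intersection with the large box carries integral 0 form a
    lambda-system containing the boxes, hence they are all the measurable sets. *)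
Lemma ae_eq0_of_box_integral (P Q : 'rV[R]_n) (k : 'rV[R]_n -> \bar R) :
  mu.-integrable (rV_box P Q) k ->
  (forall p q : 'rV[R]_n, (forall i, P ord0 i <= p ord0 i)%R ->
    (forall i, p ord0 i < q ord0 i)%R -> (forall i, q ord0 i <= Q ord0 i)%R ->
    \int[mu]_(x in rV_box p q) k x = 0) ->
  {ae mu, forall x, rV_box P Q x -> k x = 0}.
Proof.
set D := rV_box P Q => ik kpq.
have mD : measurable D by exact: measurable_rV_box.
(* Intersecting with D gives a box that is either nondegenerate and inside D, where the hypothesis
   applies, or empty. *)
have box0 (p q : 'rV[R]_n) : \int[mu]_(x in rV_box p q `&` D) k x = 0.
  rewrite /D rV_boxI.
  set p' := \row__ _; set q' := \row__ _.
  have [H|/existsNP[i /negP]] := pselect (forall i, p' ord0 i < q' ord0 i)%R.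
    apply: kpq => // i; rewrite !mxE ?le_max ?ge_min ?lexx ?orbT//.
  rewrite -leNgt => qp.
  rewrite (_ : rV_box _ _ = set0) ?integral_set0//.
  apply/seteqP; split => // x /(_ i); rewrite in_itv/= => /andP[px xq].
  by have := lt_le_trans px (le_trans xq qp); rewrite ltxx.
have D0 : \int[mu]_(x in D) k x = 0 by rewrite -(box0 P Q) setIid.
have all0 E : measurable E -> \int[mu]_(x in E `&` D) k x = 0.
  rewrite (measurable_rV_boxesE) => mE; move: E mE.
  apply: (dynkin_induction (measurable_rV_boxesE n) (@setI_closed_rV_boxes _ n)).
  - by rewrite setTI.
  - by move=> _ [p [q ->]]; exact: box0.
  - move=> S mS S0.
    have : \int[mu]_(x in (~` S `&` D) `|` (S `&` D)) k x =
        \int[mu]_(x in ~` S `&` D) k x + \int[mu]_(x in S `&` D) k x.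
      apply: integral_setU.
      - by apply: measurableI => //; exact: measurableC.
      - exact: measurableI.
      - apply: measurable_funS (measurable_int _ ik) => //.
        by rewrite -setIUl setUC setUv setTI.
      - by rewrite disj_set2E setIACA setICl set0I.
    by rewrite -setIUl setUC setUv setTI D0 S0 adde0.
  - move=> F mF tF F0; rewrite setI_bigcupl integral_bigcup.
    + by rewrite eseries0.
    + exact: trivIset_setIr.
    + by move=> i; exact: measurableI.
    + apply: integrableS ik => //.
        by apply: bigcup_measurable => i _; exact: measurableI.
      by move=> x [i _ []].
have := integral_ae_eq mD ik (measurable_cst 0).
apply => E ED mE.
by rewrite integral0 -[E](setIidl ED) all0.
Qed.

End box_integral.

(** * Smooth functions on the real line *)

Section smooth_real.
Context {R : realType}.
Implicit Types (f g h : R -> R).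

(** The derivative is an existential witness instead of [derive1 h], so that the closure properties
    can supply it by a formula. *)
Fixpoint Cn (k : nat) h : Prop :=
  match k with
  | 0 => continuous h
  | k'.+1 => exists2 h', (forall x, is_derive x (1 : R) h (h' x)) & Cn k' h'
  end.

Lemma is_derive_continuous h (dh : R -> R) :
  (forall x, is_derive x (1 : R) h (dh x)) -> continuous h.
Proof.
move=> dhh x; apply/differentiable_continuous/derivable1_diffP.
by have := dhh x => -[].
Qed.

Lemma CnS k h : Cn k.+1 h -> Cn k h.
Proof.
elim: k h => [|k IH] h [h' dh Ch']; first exact: is_derive_continuous dh.
by exists h'; [exact: dh|exact: IH].
Qed.

Lemma Cn_cst k (a : R) : Cn k (cst a).
Proof.
elim: k a => [a|k IH a]; first exact: cst_continuous.
by exists (cst 0); [move=> x; exact: is_derive_cst|exact: IH].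
Qed.

Lemma CnD k f g : Cn k f -> Cn k g -> Cn k (fun x => f x + g x).
Proof.
elim: k f g => [f g cf cg|k IH f g [f' df Cf'] [g' dg Cg']].
  by move=> x; apply: cvgD; [exact: cf|exact: cg].
by exists (fun x => f' x + g' x); [move=> x; exact: is_deriveD|exact: IH].
Qed.

Lemma CnM k f g : Cn k f -> Cn k g -> Cn k (fun x => f x * g x).
Proof.
elim: k f g => [f g cf cg|k IH f g Cf Cg].
  by move=> x; apply: cvgM; [exact: cf|exact: cg].
have [Cf0 Cg0] := (CnS Cf, CnS Cg).
move: Cf Cg => [f' df Cf'] [g' dg Cg'].
exists (fun x => f x * g' x + g x * f' x); first by move=> x; exact: is_deriveM.
by apply: CnD; exact: IH.
Qed.

Lemma CnV k f : (forall x, f x != 0) -> Cn k f -> Cn k (fun x => (f x)^-1).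
Proof.
move=> f0; elim: k => [|k IH Cf].
  by move=> cf x; apply: cvgV; [exact: f0|exact: cf].
(* The derivative - f^-1 (f^-1 f') involves the inverse itself, whose regularity one order lower is
   the induction hypothesis. *)
have CV := IH (CnS Cf); have [f' df Cf'] := Cf.
exists (fun x => -1 * (f x)^-1 * ((f x)^-1 * f' x)).
  move=> x; have [dfx <-] := df x; apply: DeriveDef.
    exact: derivableV.
  by rewrite deriveV// /GRing.scale/= -exprVn; ring.
by apply: CnM; [apply: CnM => //; exact: Cn_cst|exact: CnM].
Qed.

Lemma Cn_affine k f (a b : R) : Cn k f -> Cn k (fun x => f (a * x + b)).
Proof.
elim: k f => [f cf x|k IH f [f' df Cf']].
  apply: (@continuous_comp _ _ _ (fun x => a * x + b) f); last exact: cf.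
  by apply: cvgD; [apply: cvgM; [exact: cvg_cst|exact: cvg_id]|exact: cvg_cst].
exists (fun x => f' (a * x + b) * a).
  move=> x; apply: (@is_derive1_comp _ f (fun x => a * x + b)) => //.
  by apply: is_derive_eq; rewrite ?scaler0 ?add0r ?addr0 /GRing.scale/= mulr1.
by apply: CnM; [exact: IH|exact: Cn_cst].
Qed.

Definition smooth h := forall k, Cn k h.

Lemma smooth_derive1 h : smooth h -> smooth (derive1 h).
Proof.
move=> sh k; have [h' dh] := sh k.+1; congr (Cn k _).
by apply/funext => x; rewrite derive1E; have [_ ->] := dh x.
Qed.

Lemma smooth_is_derive h x : smooth h -> is_derive x (1 : R) h (derive1 h x).
Proof.
move=> /(_ 1)[h' dh _]; rewrite derive1E; have [d _] := dh x.
exact: DeriveDef.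
Qed.

(* The derivatives of t |-> exp(-1/t) are linear combinations of these functions. *)
Definition flat (k : nat) (t : R) : R :=
  if 0 < t then t^-1 ^+ k * expR (- t^-1) else 0.

Lemma flat_gt0 k t : 0 < t -> 0 < flat k t.
Proof. by move=> t0; rewrite /flat t0 mulr_gt0 ?expR_gt0// exprn_gt0// invr_gt0. Qed.

Lemma flat_le0 k t : t <= 0 -> flat k t = 0.
Proof. by rewrite /flat leNgt => /negbTE ->. Qed.

Lemma flat_ge0 k t : 0 <= flat k t.
Proof. by have [/flat_le0 ->|/flat_gt0 /ltW] := leP t 0. Qed.

(** Comes from s^(k+2) / (k+2)! <= exp(s) at s = 1/t. A quadratic bound is what makes the difference
    quotient at 0 tend to 0. *)
Lemma flat_le k t : flat k t <= k.+2`!%:R * t ^+ 2.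
Proof.
have [t0|t0] := leP t 0; first by rewrite flat_le0// mulr_ge0// sqr_ge0.
rewrite /flat t0; set s := t^-1; have s0 : 0 < s by rewrite invr_gt0.
rewrite expRN ler_pdivrMr ?expR_gt0//.
have se := expR_ge1Dxn k.+1 (ltW s0).
have {se} : s ^+ k.+2 / k.+2`!%:R <= expR s by apply: le_trans se; rewrite lerDr.
rewrite ler_pdivrMr ?ltr0n ?fact_gt0// => se.
have -> : s ^+ k = s ^+ k.+2 * t ^+ 2.
  by rewrite -[k.+2]addn2 exprD -mulrA -exprMn mulVf ?gt_eqF// expr1n mulr1.
by rewrite [leRHS]mulrAC ler_pM2r ?exprn_gt0// mulrC.
Qed.

Lemma is_derive_flat k t :
  is_derive t (1 : R) (flat k) (flat k.+2 t - k%:R * flat k.+1 t).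
Proof.
have [t0|t0|->] := ltgtP t 0.
- rewrite !flat_le0 ?ltW// mulr0 subr0.
  apply: (@near_eq_is_derive _ _ _ (cst 0)) => //.
  by near=> s; rewrite flat_le0// ltW//; near: s; exact: lt_nbhsl.
- have fE : \near t, t^-1 ^+ k * expR (- t^-1) = flat k t.
    by near=> s; rewrite /flat ifT//; near: s; exact: lt_nbhsr.
  apply: near_eq_is_derive fE _.
  have dV : is_derive t (1 : R) (fun s : R => s^-1) (- t ^- 2).
    apply: DeriveDef; first by apply: derivableV; rewrite ?gt_eqF.
    by rewrite (@deriveV _ _ id) ?gt_eqF// derive_id /GRing.scale/= mulr1.
  have dE : is_derive t (1 : R) (fun s => expR (- s^-1)) (expR (- t^-1) * t ^- 2).
    apply: (@is_derive1_comp _ expR (fun s : R => - s^-1)).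
    by rewrite -[t ^- 2]opprK; exact: is_deriveN.
  have := is_deriveM (is_deriveX k dV) dE; rewrite exprfctE => dM.
  apply: (is_derive_eq dM); rewrite /flat t0 /GRing.scale/=.
  rewrite -[t ^- 2]exprVn; set s := t^-1; set E := expR _.
  case: k {dM} => [|k] /=; first by ring.
  by rewrite !exprS; ring.
(* At the origin the quotient is at most (k+2)! |h| in absolute value. *)
rewrite !flat_le0// mulr0 subr0.
suff H : (h^-1 *: ((flat k \o shift 0) (h *: (1:R)) - flat k 0) @[h --> 0^'] --> (0:R)).
  by apply: DeriveDef; [apply/cvg_ex; exists 0|exact: cvg_lim].
apply/cvgr0Pnorm_lt => e e0; near=> h.
rewrite /= addr0 [h *: 1]mulr1 (flat_le0 k (lexx 0)) ?subr0 normrZ.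
have h0 : h != 0 by near: h; exact: nbhs_dnbhs_neq.
rewrite (ger0_norm (flat_ge0 _ _)) normfV ltr_pdivrMl ?normr_gt0//.
apply: le_lt_trans (flat_le _ _) _.
rewrite -real_normK ?num_real// expr2 mulrA mulrC ltr_pM2l ?normr_gt0//.
rewrite mulrC -ltr_pdivlMr ?ltr0n ?fact_gt0//; near: h.
apply: dnbhs0_lt; by rewrite divr_gt0// ltr0n fact_gt0.
Unshelve. all: by end_near. Qed.

Lemma smooth_flat k : smooth (flat k).
Proof.
move=> n; elim: n k => [|n IH] k.
  exact: is_derive_continuous (is_derive_flat k).
exists (fun t => flat k.+2 t + (- k%:R) * flat k.+1 t).
  by move=> t; rewrite mulNr; exact: is_derive_flat.
by apply: CnD; [exact: IH|apply: CnM; [exact: Cn_cst|exact: IH]].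
Qed.

(** The classical smooth transition from 0 on t <= 0 to 1 on t >= 1, with [flat 0 t] equal to
    exp(-1/t) for t > 0; the denominator is positive since t and 1 - t are never both
    nonpositive. *)
Definition step (t : R) : R := flat 0 t / (flat 0 t + flat 0 (1 - t)).

Lemma step_den_gt0 t : 0 < flat 0 t + flat 0 (1 - t).
Proof.
have [t0|t0] := ltP 0 t; first by rewrite ltr_wpDr ?flat_ge0 ?flat_gt0.
by rewrite ltr_wpDl ?flat_ge0// flat_gt0//; lra.
Qed.

Lemma smooth_step : smooth step.
Proof.
move=> k; apply: CnM; first exact: smooth_flat.
apply: CnV; first by move=> t; rewrite gt_eqF// step_den_gt0.
apply: CnD; first exact: smooth_flat.
rewrite (_ : (fun t => _) = (fun t => flat 0 (- 1 * t + 1))).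
  by apply: (@Cn_affine _ (flat 0)); exact: smooth_flat.
by apply/funext => t; congr flat; ring.
Qed.

Lemma step_le0 t : t <= 0 -> step t = 0.
Proof. by move=> t0; rewrite /step flat_le0// mul0r. Qed.

Lemma step_ge1 t : 1 <= t -> step t = 1.
Proof.
move=> t1; rewrite /step [flat 0 (1 - t)]flat_le0 ?subr_le0// addr0 divff//.
by rewrite gt_eqF// flat_gt0//; lra.
Qed.

Lemma step_ge0 t : 0 <= step t.
Proof. by rewrite divr_ge0 ?flat_ge0// ltW// step_den_gt0. Qed.

Lemma step_le1 t : step t <= 1.
Proof.
by rewrite ler_pdivrMr ?step_den_gt0// mul1r lerDl flat_ge0.
Qed.

End smooth_real.

(** * Test functions with separated variables *)

Section tensor_products.
Context {R : realType} {n : nat}.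
Implicit Types (psi : 'I_n -> R -> R) (x : 'rV[R]_n).

Definition tensor psi x : R := \prod_i psi i (x ord0 i).

Definition update psi i (h : R -> R) : 'I_n -> R -> R :=
  fun j => if j == i then h else psi j.

Lemma tensorE i psi x :
  tensor psi x = psi i (x ord0 i) * \prod_(j < n | j != i) psi j (x ord0 j).
Proof. by rewrite /tensor (bigD1 i). Qed.

Lemma tensor_update i psi h x : tensor (update psi i h) x =
  h (x ord0 i) * \prod_(j < n | j != i) psi j (x ord0 j).
Proof.
rewrite (tensorE i) /update eqxx; congr (_ * _).
by apply: eq_bigr => j /negbTE ->.
Qed.

Lemma is_derive_tensor psi i x (dh : R) :
  is_derive (x ord0 i) (1 : R) (psi i) dh ->
  is_derive x (delta_mx ord0 i) (tensor psi)
    (dh * \prod_(j < n | j != i) psi j (x ord0 j)).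
Proof.
set c := \prod_(j < n | _) _ => dpsi.
have [d1 d2] := is_deriveZ c dpsi.
have E : (fun h : R => h^-1 *: ((tensor psi \o shift x) (h *: delta_mx ord0 i) - tensor psi x))
    = (fun h : R => h^-1 *: (((c \*: psi i) \o shift (x ord0 i)) (h *: (1 : R))
      - (c \*: psi i) (x ord0 i))).
  apply/funext => h /=; congr (_ *: _); rewrite !(tensorE i) !mxE !eqxx.
  congr (_ - _); last by rewrite mulrC.
  rewrite [RHS]mulrC (_ : \prod_(j < n | _) _ = c); first by [].
  apply: eq_bigr => j /negbTE ji.
  by rewrite !mxE ji andbF mulr0 add0r.
apply: DeriveDef; first by rewrite /derivable E; exact: d1.
by rewrite /derive E; rewrite [LHS]d2 mulrC.
Qed.

Lemma partial_tensor psi i : (forall j, smooth (psi j)) ->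
  partial i (tensor psi) = tensor (update psi i (derive1 (psi i))).
Proof.
move=> spsi; apply/funext => x; rewrite /partial tensor_update.
by have [_ ->] := is_derive_tensor (smooth_is_derive (x ord0 i) (spsi i)).
Qed.

Lemma smooth_update psi i h : (forall j, smooth (psi j)) -> smooth h ->
  forall j, smooth (update psi i h j).
Proof. by move=> spsi sh j; rewrite /update; case: ifP. Qed.

Lemma continuous_tensor psi : (forall i, smooth (psi i)) -> continuous (tensor psi).
Proof.
move=> spsi; rewrite /tensor.
elim: (index_enum _) => [|i s IH].
  have -> : (fun x : 'rV[R]_n => \prod_(j <- [::]) psi j (x ord0 j)) = cst 1.
    by apply/funext => y; rewrite big_nil.
  exact: cst_continuous.
have -> : (fun x : 'rV[R]_n => \prod_(j <- i :: s) psi j (x ord0 j)) =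
    (fun x : 'rV[R]_n => psi i (x ord0 i) * \prod_(j <- s) psi j (x ord0 j)).
  by apply/funext => y; rewrite big_cons.
move=> x.
have ci : {for x, continuous (psi i \o (fun x : 'rV[R]_n => x ord0 i))}.
  by apply: continuous_comp; [exact: coord_continuous|exact: (spsi i 0%N)].
exact: (cvgM ci (IH x)).
Qed.

(** Products of smooth profiles are stable under partial derivatives, which replace one factor by
    its derivative; the induction on k therefore ranges over all [psi]. *)
Lemma Ck_on_tensor k psi : (forall i, smooth (psi i)) -> Ck_on k setT (tensor psi).
Proof.
elim: k psi => [|k IH] psi spsi.
  by split => // x _; exact: continuous_tensor.
split; first by move=> x _; exact: continuous_tensor.
move=> i; split.
  move=> x _.
  by have [] := is_derive_tensor (smooth_is_derive (x ord0 i) (spsi i)).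
rewrite partial_tensor//; apply: IH; apply: smooth_update => //.
exact: smooth_derive1.
Qed.

Lemma compact_closed_box (p q : 'rV[R]_n) :
  compact [set x : 'rV[R]_n | forall i, x ord0 i \in `[p ord0 i, q ord0 i]].
Proof.
by apply: (@rV_compact _ _ (fun i => `[p ord0 i, q ord0 i]%classic)) => i;
  exact: segment_compact.
Qed.

Lemma Cc_smooth_tensor (U : set 'rV[R]_n) psi (p q : 'rV[R]_n) :
  (forall i, smooth (psi i)) ->
  (forall i t, t \notin `[p ord0 i, q ord0 i] -> psi i t = 0) ->
  [set x : 'rV[R]_n | forall i, x ord0 i \in `[p ord0 i, q ord0 i]] `<=` U ->
  Cc_smooth U (tensor psi).
Proof.
set B := [set x | _] => spsi psi0 BU.
have cB : compact B by exact: compact_closed_box.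
have supB : closure [set x | tensor psi x != 0] `<=` B.
  have cldB : closed B by exact: compact_closed.
  rewrite [X in _ `<=` X](closure_id _).1//; apply: closure_subset => x /=.
  move=> t0 i; apply: contraNT t0 => xi.
  by rewrite (tensorE i) psi0// mul0r.
split; first by move=> k; exact: Ck_on_tensor.
  by apply: subclosed_compact supB => //; exact: closed_closure.
exact: subset_trans supB BU.
Qed.

Lemma tensor_bound psi (M : R) x : (forall i t, `|psi i t| <= M) ->
  `|tensor psi x| <= M ^+ n.
Proof.
move=> psiM; rewrite normr_prod -[X in _ ^+ X]card_ord -prodr_const.
by apply: ler_prod => i _; rewrite normr_ge0 psiM.
Qed.

Lemma cvg_tensor (psi : nat -> 'I_n -> R -> R) (psioo : 'I_n -> R -> R) x :
  (forall i t, psi k i t @[k --> \oo] --> psioo i t) ->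
  tensor (psi k) x @[k --> \oo] --> tensor psioo x.
Proof.
move=> cpsi; rewrite /tensor.
elim: (index_enum _) => [|i s IH].
  rewrite big_nil.
  have -> : (fun k => \prod_(j <- [::]) psi k j (x ord0 j)) = cst 1.
    by apply/funext => y; rewrite big_nil.
  exact: cvg_cst.
rewrite big_cons.
have -> : (fun k => \prod_(j <- i :: s) psi k j (x ord0 j)) =
    (fun k => psi k i (x ord0 i) * \prod_(j <- s) psi k j (x ord0 j)).
  by apply/funext => y; rewrite big_cons.
by apply: cvgM; [exact: cpsi|exact: IH].
Qed.

(** Dominated convergence with majorant M^n |g|. The limit profiles may be discontinuous: the
    measurability of the limit integrand comes from the pointwise convergence. *)
Lemma cvg_Rintegral_tensor (U : set 'rV[R]_n) (g : 'rV[R]_n -> R)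
    (psi : nat -> 'I_n -> R -> R) (psioo : 'I_n -> R -> R) (M : R) :
  open U -> (lebesgue_rV R n).-integrable U (EFin \o g) ->
  (forall k i, smooth (psi k i)) ->
  (forall i t, psi k i t @[k --> \oo] --> psioo i t) ->
  (forall k i t, `|psi k i t| <= M) ->
  \int[lebesgue_rV R n]_(x in U) (g x * tensor (psi k) x) @[k --> \oo] -->
  \int[lebesgue_rV R n]_(x in U) (g x * tensor psioo x).
Proof.
move=> oU ig spsi cpsi psiM.
have mU := rV_open_measurable oU.
have mg : measurable_fun U g by apply/measurable_EFinP; exact: measurable_int ig.
have mgt k : measurable_fun U (fun x => g x * tensor (psi k) x).
  apply: measurable_funM => //; apply: rV_continuous_measurable => // x _.
  exact: continuous_tensor.
have igM : (lebesgue_rV R n).-integrable U (EFin \o (fun x => `|g x| * M ^+ n)).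
  have := integrableZl mU (M ^+ n) (integrable_norm ig).
  apply: eq_integrable => // x _ /=.
  by rewrite -EFinM mulrC.
have bound k x : U x -> (`|(g x * tensor (psi k) x)%:E| <= (`|g x| * M ^+ n)%:E)%E.
  move=> Ux; rewrite lee_fin normrM ler_wpM2l//.
  by apply: tensor_bound => *; exact: psiM.
have cv x : U x -> (g x * tensor (psi k) x)%:E @[k --> \oo] --> (g x * tensor psioo x)%:E.
  move=> Ux; apply: cvg_EFin; first exact: nearW.
  by apply: cvgM; [exact: cvg_cst|exact: cvg_tensor].
have mf k : measurable_fun U (fun x => (g x * tensor (psi k) x)%:E).
  exact/measurable_EFinP.
have mfoo : measurable_fun U (fun x => (g x * tensor psioo x)%:E).
  exact: (emeasurable_fun_cvg _ _ mf cv).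
have [fi _ H] := dominated_convergence mU mf mfoo (aeW _ cv) igM
  (aeW _ (fun x k Ux => bound k x Ux)).
rewrite /Rintegral; apply: fine_cvg; rewrite fineK//.
exact: integrable_fin_num.
Qed.

End tensor_products.

(** * Smooth approximations of steps, ramps and trapezoids *)

Section smoothed_ramps.
Context {R : realType}.
Implicit Types (s t e : R).

(** The value at 0 is 0, so that differences of translates are indicators of the left-open,
    right-closed intervals from which boxes are made. *)
Definition heaviside t : R := (0 < t)%R%:R.
Definition ramp t : R := t * heaviside t.

Definition sstep e t : R := step (e^-1 * t).
Definition sramp e t : R := t * sstep e t.
Definition dramp e t : R := sstep e t + e^-1 * t * derive1 step (e^-1 * t).

Lemma smooth_sstep e : smooth (sstep e).
Proof.
move=> k; have := @Cn_affine _ k step e^-1 0 (smooth_step k).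
by congr Cn; apply/funext => t; rewrite addr0.
Qed.

Lemma smooth_id : smooth (@id R).
Proof.
case=> [|k]; first by move=> x; exact: cvg_id.
by exists (cst 1); [move=> x; exact: is_derive_id|exact: Cn_cst].
Qed.

Lemma smooth_sramp e : smooth (sramp e).
Proof. by move=> k; apply: CnM; [exact: smooth_id|exact: smooth_sstep]. Qed.

Lemma smooth_shift h c : smooth h -> smooth (fun t : R => h (t - c)).
Proof.
move=> sh k; have := @Cn_affine _ k h 1 (- c) (sh k).
by congr Cn; apply/funext => t; rewrite mul1r.
Qed.

Lemma is_derive_sramp e t : is_derive t (1 : R) (sramp e) (dramp e t).
Proof.
have ds : is_derive t (1 : R) (sstep e) (derive1 step (e^-1 * t) * e^-1).
  apply: (@is_derive1_comp _ step (fun t => e^-1 * t)).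
    exact/smooth_is_derive/smooth_step.
  have := is_deriveZ e^-1 (@is_derive_id _ R t (1 : R)).
  by rewrite [_ *: 1]mulr1.
have di := @is_derive_id _ R t (1 : R).
have dm := is_deriveM di ds.
by apply: (is_derive_eq dm); rewrite /dramp /GRing.scale/=; ring.
Qed.

Lemma is_derive_shift h c t (dh : R) : is_derive (t - c) (1 : R) h dh ->
  is_derive t (1 : R) (fun t : R => h (t - c)) dh.
Proof.
move=> dhc; rewrite -[dh]mulr1; apply: (@is_derive1_comp _ h (fun t => t - c)) => //.
by apply: is_derive_eq; rewrite subr0.
Qed.

Lemma sstep_le0 e t : 0 < e -> t <= 0 -> sstep e t = 0.
Proof. by move=> e0 t0; rewrite /sstep step_le0// mulr_ge0_le0// invr_ge0 ltW. Qed.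

Lemma sstep_ge e t : 0 < e -> e <= t -> sstep e t = 1.
Proof. by move=> e0 et; rewrite /sstep step_ge1// mulrC ler_pdivlMr// mul1r. Qed.

Lemma derive1_step_notin t : t \notin `[0, 1] -> derive1 step t = 0.
Proof.
rewrite in_itv/= negb_and -!ltNge => /orP[t0|t1].
  transitivity (derive1 (cst 0 : R -> R) t); last by rewrite derive1_cst.
  rewrite !derive1E; apply: near_eq_derive; near=> s.
  by rewrite step_le0// ltW//; near: s; exact: lt_nbhsl.
transitivity (derive1 (cst 1 : R -> R) t); last by rewrite derive1_cst.
rewrite !derive1E; apply: near_eq_derive; near=> s.
by rewrite step_ge1// ltW//; near: s; exact: lt_nbhsr.
Unshelve. all: by end_near. Qed.

Lemma dramp_le0 e t : 0 < e -> t <= 0 -> dramp e t = 0.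
Proof.
move=> e0 t0; rewrite /dramp sstep_le0// add0r.
move: t0; rewrite le_eqVlt => /predU1P[->|t0]; first by rewrite mulr0 mul0r.
rewrite derive1_step_notin ?mulr0// in_itv/= negb_and -ltNge pmulr_rlt0 ?t0//.
by rewrite invr_gt0.
Qed.

Lemma dramp_gt e t : 0 < e -> e < t -> dramp e t = 1.
Proof.
move=> e0 et; rewrite /dramp sstep_ge// ?ltW// derive1_step_notin ?mulr0 ?addr0//.
by rewrite in_itv/= negb_and -!ltNge mulrC ltr_pdivlMr// mul1r et orbT.
Qed.

(** [dramp e t] depends on s = t/e only, through step(s) + s step'(s), and step' vanishes outside
    [0, 1]; hence a bound uniform in e, as dominated convergence requires. *)
Lemma dramp_bounded : exists K : R, forall e t, `|dramp e t| <= K.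
Proof.
have : compact ((derive1 step : R -> R) @` `[0, 1]).
  apply: continuous_compact; last exact: segment_compact.
  apply: continuous_subspaceT => x.
  exact: (smooth_derive1 (@smooth_step R) 0%N).
move=> /compact_bounded[M [_ HM]].
exists (1 + (`|M| + 1)) => e t; rewrite (le_trans (ler_normD _ _))// lerD//.
  by rewrite ger0_norm ?step_ge0 ?step_le1.
set s := e^-1 * t; have [s01|s01] := boolP (s \in `[0, 1]); last first.
  by rewrite derive1_step_notin// mulr0 normr0 addr_ge0.
rewrite normrM; have : `|derive1 step s| <= `|M| + 1.
  by apply: HM; [rewrite (le_lt_trans (ler_norm _))// ltrDl|exists s].
move: s01; rewrite in_itv/= => /andP[s0 s1]; rewrite (ger0_norm s0).
by apply: le_trans; rewrite ler_piMl.
Qed.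

Variable d : R.
Hypothesis d0 : 0 < d.
(** Smoothing widths that tend to 0 and never exceed d, the margin by which smoothed profiles may
    overrun their interval on the right. *)
Let e_ (k : nat) : R := d / k.+1%:R.

Let e_gt0 k : 0 < e_ k. Proof. by rewrite divr_gt0. Qed.

Let e_le k : e_ k <= d.
Proof. by rewrite ler_pdivrMr// ler_peMr ?ler1n// ltW. Qed.

Let near_e t : 0 < t -> \forall k \near \oo, e_ k < t.
Proof.
move=> t0; exists (Num.truncn (d / t)).+1 => // k /= kt.
rewrite /e_ ltr_pdivrMr// mulrC -ltr_pdivrMr//.
apply: lt_trans (truncnS_gt _) _; by rewrite ltr_nat ltnS.
Qed.

(** The transition takes place in [0, e], to the right of 0, so the sequence is eventually constant
    at every t, including t = 0. *)
Lemma cvg_sstep t : sstep (e_ k) t @[k --> \oo] --> heaviside t.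
Proof.
apply: cvg_near_cst; have [t0|t0] := ltP 0 t.
  by near do rewrite /heaviside t0 sstep_ge// ltW//; exact: near_e.
by apply: nearW => k; rewrite sstep_le0// /heaviside ltNge t0.
Unshelve. all: by end_near. Qed.

Lemma cvg_dramp t : dramp (e_ k) t @[k --> \oo] --> heaviside t.
Proof.
apply: cvg_near_cst; have [t0|t0] := ltP 0 t.
  by near do rewrite /heaviside t0 dramp_gt//; exact: near_e.
by apply: nearW => k; rewrite dramp_le0// /heaviside ltNge t0.
Unshelve. all: by end_near. Qed.

Lemma cvg_sramp t : sramp (e_ k) t @[k --> \oo] --> ramp t.
Proof. by apply: cvgM; [exact: cvg_cst|exact: cvg_sstep]. Qed.

Definition bump h (p q t : R) : R := h (t - p) - h (t - q).

(* [trap heaviside A B b] is (B - A) 1_]A,b] - (b - A) 1_]A,B], of integral 0, and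
   [trap ramp A B b] is its primitive with support in [A, B]. *)
Definition trap h (A B b t : R) : R := (B - A) * bump h A b t - (b - A) * bump h A B t.

Lemma smooth_bump h p q : smooth h -> smooth (bump h p q).
Proof.
move=> sh k; have := CnD (smooth_shift p sh k)
  (CnM (Cn_cst k (-1)) (smooth_shift q sh k)).
by congr Cn; apply/funext => t; rewrite mulN1r.
Qed.

Lemma smooth_trap h A B b : smooth h -> smooth (trap h A B b).
Proof.
move=> sh k; have := CnD (CnM (Cn_cst k (B - A)) (smooth_bump A b sh k))
  (CnM (Cn_cst k (- (b - A))) (smooth_bump A B sh k)).
by congr Cn; apply/funext => t; rewrite mulNr.
Qed.

Lemma derive1_trap e A B b : derive1 (trap (sramp e) A B b) = trap (dramp e) A B b.
Proof.
apply/funext => t.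
have db p q : is_derive t (1 : R) (bump (sramp e) p q) (bump (dramp e) p q t).
  by apply: is_deriveB; apply: is_derive_shift; exact: is_derive_sramp.
rewrite derive1E.
by have [_] := is_deriveB (is_deriveZ (B - A) (db A b)) (is_deriveZ (b - A) (db A B)).
Qed.

Lemma cvg_bump (h : nat -> R -> R) hoo p q t : (forall t, h k t @[k --> \oo] --> hoo t) ->
  bump (h k) p q t @[k --> \oo] --> bump hoo p q t.
Proof. by move=> hh; apply: cvgB; exact: hh. Qed.

Lemma cvg_trap (h : nat -> R -> R) hoo A B b t : (forall t, h k t @[k --> \oo] --> hoo t) ->
  trap (h k) A B b t @[k --> \oo] --> trap hoo A B b t.
Proof.
by move=> hh; apply: cvgB; apply: cvgM; first [exact: cvg_cst|exact: cvg_bump].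
Qed.

Lemma bump_sstep_eq0 e p q c t : 0 < e -> p <= q -> q + e <= c ->
  t \notin `[p, c] -> bump (sstep e) p q t = 0.
Proof.
move=> e0 pq qc; rewrite in_itv/= negb_and -!ltNge /bump => /orP[tp|ct].
  by rewrite !sstep_le0 ?subrr//; lra.
by rewrite !sstep_ge ?subrr//; lra.
Qed.

Lemma bump_sstep_le1 e p q t : `|bump (sstep e) p q t| <= 1.
Proof.
have := step_ge0 (e^-1 * (t - p)); have := step_le1 (e^-1 * (t - p)).
have := step_ge0 (e^-1 * (t - q)); have := step_le1 (e^-1 * (t - q)).
by rewrite /bump /sstep ler_norml; lra.
Qed.

Lemma trap_sramp_eq0 e A B b c t : 0 < e -> A <= b <= B -> B + e <= c ->
  t \notin `[A, c] -> trap (sramp e) A B b t = 0.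
Proof.
move=> e0 /andP[Ab bB] Bc; rewrite in_itv/= negb_and -!ltNge /trap /bump /sramp.
move=> /orP[tp|ct].
  by rewrite !sstep_le0 ?mulr0 ?subrr//; lra.
(* Past B + e all steps equal 1 and the two bumps cancel: (B - A)(b - A) - (b - A)(B - A) = 0. This
   gives the compact support that a single ramp bump would not have. *)
by rewrite !sstep_ge//; lra.
Qed.

Lemma trap_bound h A B b t (K : R) : A <= b <= B ->
  `|h (t - A)| <= K -> `|h (t - b)| <= K -> `|h (t - B)| <= K ->
  `|trap h A B b t| <= 4 * (B - A) * K.
Proof.
move=> /andP[Ab bB] hA hb hB; rewrite /trap /bump.
rewrite (le_trans (ler_normB _ _))// !normrM.
have -> : 4 * (B - A) * K = (B - A) * (K + K) + (B - A) * (K + K) by ring.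
by apply: lerD; apply: ler_pM => //; first [by rewrite ger0_norm; lra |
  by rewrite (le_trans (ler_normB _ _))// lerD].
Qed.

Lemma trap_sramp_bound e A B b t : 0 < e -> e <= d -> A <= b <= B ->
  `|trap (sramp e) A B b t| <= 4 * (B - A) * (B - A + d).
Proof.
move=> e0 ed AbB; have /andP[Ab bB] := AbB.
have [|tAB] := boolP (t \in `[A, B + d]); last first.
  rewrite (trap_sramp_eq0 e0 AbB _ tAB) ?lerD2l// normr0.
  by rewrite !mulr_ge0//; lra.
rewrite in_itv/= => /andP[At tB].
apply: trap_bound => //; rewrite normrM -[leRHS]mulr1; apply: ler_pM => //;
  rewrite ?(ger0_norm (step_ge0 _)) ?step_le1// ler_norml; lra.
Qed.

(** Integration by parts against a Lipschitz trapezoid times indicators, although the hypothesis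
    only covers C_c^oo tests: both sides are limits of the identity for smoothed profiles. The
    margin d on the right keeps the smoothed supports inside [U]. *)
Lemma weak_trapezoid n (U : set 'rV[R]_n) (i : 'I_n) (g f : 'rV[R]_n -> R)
    (P Q p q : 'rV[R]_n) (b : R) :
  open U ->
  (lebesgue_rV R n).-integrable U (EFin \o g) ->
  (lebesgue_rV R n).-integrable U (EFin \o f) ->
  (forall phi, Cc_smooth U phi ->
    \int[lebesgue_rV R n]_(x in U) (g x * partial i phi x) =
    - \int[lebesgue_rV R n]_(x in U) (f x * phi x)) ->
  [set x : 'rV[R]_n | forall j, x ord0 j \in `[P ord0 j, Q ord0 j + d]] `<=` U ->
  (forall j, P ord0 j <= p ord0 j) -> (forall j, p ord0 j < q ord0 j) ->
  (forall j, q ord0 j <= Q ord0 j) ->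
  P ord0 i <= b <= Q ord0 i ->
  let psi h := update (fun j => bump heaviside (p ord0 j) (q ord0 j)) i
    (trap h (P ord0 i) (Q ord0 i) b) in
  \int[lebesgue_rV R n]_(x in U) (g x * tensor (psi heaviside) x) =
  - \int[lebesgue_rV R n]_(x in U) (f x * tensor (psi ramp) x).
Proof.
move=> oU ig if_ weak PQU Pp pq qQ PbQ psi.
pose psik h k := update (fun j => bump (sstep (e_ k)) (p ord0 j) (q ord0 j)) i
    (trap h (P ord0 i) (Q ord0 i) b).
have s_psik h k : smooth h -> forall j, smooth (psik h k j).
  move=> sh; apply: smooth_update; last exact: smooth_trap.
  by move=> j; apply: smooth_bump; exact: smooth_sstep.
have partial_psik k : partial i (tensor (psik (sramp (e_ k)) k)) =
    tensor (psik (dramp (e_ k)) k).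
  rewrite partial_tensor; last exact/s_psik/smooth_sramp.
  congr tensor; apply/funext => j; rewrite /psik /update eqxx.
  by case: ifP => ji; [rewrite derive1_trap|rewrite ji].
have sd_psik k j : smooth (psik (dramp (e_ k)) k j).
  rewrite /psik; apply: smooth_update => //.
    by move=> j'; apply: smooth_bump; exact: smooth_sstep.
  by rewrite -derive1_trap; apply/smooth_derive1/smooth_trap/smooth_sramp.
have cvg_psik (h : nat -> R -> R) hoo j t : (forall t, h k t @[k --> \oo] --> hoo t) ->
    psik (h k) k j t @[k --> \oo] --> psi hoo j t.
  move=> hh; rewrite /psik /psi /update; case: ifP => _; first exact: cvg_trap.
  by apply: cvg_bump; exact: cvg_sstep.
have bound_psik (h : nat -> R -> R) (M : R) :
    (forall k t, `|trap (h k) (P ord0 i) (Q ord0 i) b t| <= M) ->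
    forall k j t, `|psik (h k) k j t| <= Num.max M 1.
  move=> hM k j t; rewrite /psik /update; case: ifP => _; rewrite le_max ?hM//.
  by rewrite bump_sstep_le1 orbT.
have weak_k k := weak (tensor (psik (sramp (e_ k)) k)).
have [K HK] := dramp_bounded.
(* The derivative of the smoothed ramp is [dramp], not [sstep], but it has the same pointwise limit
   [heaviside]. *)
have lim_g := cvg_Rintegral_tensor oU ig sd_psik
  (fun j t => cvg_psik (fun k => dramp (e_ k)) heaviside j t cvg_dramp)
  (bound_psik (fun k => dramp (e_ k)) _
    (fun k t => trap_bound PbQ (HK _ _) (HK _ _) (HK _ _))).
have lim_f := cvg_Rintegral_tensor oU if_ (fun k => s_psik _ k (smooth_sramp _))
  (fun j t => cvg_psik (fun k => sramp (e_ k)) ramp j t cvg_sramp)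
  (bound_psik (fun k => sramp (e_ k)) _
    (fun k t => trap_sramp_bound t (e_gt0 k) (e_le k) PbQ)).
apply: (cvg_unique _ lim_g) => //; move/cvgN : lim_f; apply: cvg_trans.
apply: near_eq_cvg; apply: nearW => k.
rewrite -partial_psik; apply/esym/weak_k.
apply: (@Cc_smooth_tensor _ _ _ _ P (\row_j (Q ord0 j + d))).
- exact/s_psik/smooth_sramp.
- move=> j t; rewrite mxE /psik /update; case: ifP => [/eqP ->|_] tPQ.
    by apply: trap_sramp_eq0 tPQ => //; rewrite lerD2l.
  apply: (@bump_sstep_eq0 _ _ _ (Q ord0 j + d)) => //; first exact/ltW.
    by rewrite lerD.
  by move: tPQ; rewrite !in_itv/=; apply: contra => /andP[/(le_trans (Pp j)) -> ->].
- by apply: subset_trans PQU => x /= xPQ j; have := xPQ j; rewrite mxE.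
Qed.

End smoothed_ramps.

(** * Weak derivatives on the real line *)

Section real_line.
Context {R : realType}.
Local Notation leb := (@lebesgue_measure R).
Implicit Types (f g : R -> R) (x : R).

Definition primitive f x : R := \int[leb]_(t in `]-oo, x]) f t.

Lemma primitiveB f x y : leb.-integrable setT (EFin \o f) -> x <= y ->
  primitive f y - primitive f x = \int[leb]_(t in `]x, y]) f t.
Proof.
move=> If xy; rewrite /primitive Rintegral_itvB//.
by apply: integrableS If.
Qed.

Lemma primitive_continuous f : leb.-integrable setT (EFin \o f) ->
  continuous (primitive f).
Proof.
move=> If x; apply/cvgrPdist_lt => e e0.
have /=[d [d0 dA]] := integral_normr_continuous If e0.
have bnd a b : a <= b -> b - a < d -> `|primitive f b - primitive f a| < e.
  move=> ab bad; rewrite primitiveB//.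
  apply: le_lt_trans (le_normr_Rintegral _ _) _ => //; first exact: integrableS If.
  apply: dA => //; rewrite lebesgue_measure_itv/=.
  by case: ifP => _; rewrite ?lte_fin// -EFinB lte_fin.
near=> y; have xyd : `|x - y| < d by near: y; exact: cvgr_dist_lt.
have [xy|yx] := leP x y.
  by rewrite distrC; apply: bnd => //; rewrite (le_lt_trans (ler_norm _))// distrC.
by apply: bnd; [exact: ltW|rewrite (le_lt_trans (ler_norm _))].
Unshelve. all: by end_near. Qed.

Lemma integrable_locally f : leb.-integrable setT (EFin \o f) ->
  locally_integrable setT f.
Proof. by move=> If; apply: open_integrable_locally => //; exact: openT. Qed.

Lemma ae_is_derive_primitive f : leb.-integrable setT (EFin \o f) ->
  {ae leb, forall x, is_derive x (1 : R) (primitive f) (f x)}.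
Proof.
move=> If.
have Iy y : leb.-integrable `]-oo, y] (EFin \o f) by apply: integrableS If.
have /= H := FTC1Ny Iy (integrable_locally If).
apply: (filterS _ H); first exact: (ae_filter_ringOfSetsType leb).
move=> x []; rewrite -/(primitive f); rewrite derive1E => dx <-; exact: DeriveDef.
Qed.

Lemma ae_exists_itv (P : R -> Prop) (a b : R) : a < b -> {ae leb, forall x, P x} ->
  exists2 x, a < x < b & P x.
Proof.
move=> ab [N [mN N0 PN]]; apply: contrapT => nP.
have : (leb `]a, b[%classic <= leb N)%E.
  apply: le_measure; rewrite ?inE// => x /=; rewrite in_itv/= => axb.
  by apply: PN => /= Px; apply: nP; exists x.
by rewrite N0 lebesgue_measure_itv/= lte_fin ab leNgt -EFinB lte_fin subr_gt0 ab.
Qed.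

Lemma is_derive_local_min f x (df : R) : is_derive x (1 : R) f df ->
  (\forall y \near x, f x <= f y) -> df = 0.
Proof.
move=> [dfx dfE] fmin.
have cv : h^-1 *: ((f \o shift x) (h *: (1 : R)) - f x) @[h --> 0^'] --> df.
  by rewrite -dfE; exact: dfx.
have nmin : \forall h \near (0 : R), f x <= f (h + x).
  have : (h + x) @[h --> (0 : R)] --> x.
    by rewrite -[X in _ --> X]add0r; apply: cvgD; [exact: cvg_id|exact: cvg_cst].
  by move=> /(_ _ fmin).
apply/eqP; rewrite eq_le; apply/andP; split.
  apply: (cvgr_to_le (cvg_dnbhs_at_left cv)); near=> h.
  rewrite /= [_%:A]mulr1; apply: mulr_le0_ge0; last first.
    by rewrite subr_ge0; near: h; apply: cvg_within.
  by rewrite invr_le0 ltW.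
apply: (cvgr_to_ge (cvg_dnbhs_at_right cv)); near=> h.
rewrite /= [_%:A]mulr1; apply: mulr_ge0; last first.
  by rewrite subr_ge0; near: h; apply: cvg_within.
by rewrite invr_ge0 ltW.
Unshelve. all: by end_near. Qed.

Lemma bump_heavisideE (p q t : R) : p <= q -> bump heaviside p q t = \1_`]p, q] t.
Proof.
move=> pq; rewrite /bump /heaviside indicE mem_setE in_itv/= !subr_gt0.
case: (ltP p t) => pt; case: (leP t q) => qt //=; rewrite ?subr0 ?subrr//.
by move: pt; rewrite leNgt (le_lt_trans pq qt).
Qed.

(** Writes (t - p)^+ - (t - q)^+ as the integral over s in ]p, q] of the indicator of s < t, the
    form in which Fubini applies. *)
Lemma measure_itv_below (p q t : R) : p <= q ->
  leb (`]p, q] `&` `]-oo, t[)%classic = (bump ramp p q t)%:E.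
Proof.
move=> pq; rewrite /bump /ramp /heaviside !subr_gt0.
have [tp|pt] := leP t p.
  rewrite [q < t]ltNge (le_trans tp pq) !mulr0 subrr.
  rewrite (_ : _ `&` _ = set0) ?measure0//.
  apply/seteqP; split => // x [/=]; rewrite !in_itv/= => /andP[px _] xt.
  by have := lt_le_trans (lt_trans px xt) tp; rewrite ltxx.
rewrite mulr1; have [tq|qt] := leP t q.
  rewrite mulr0 subr0 (_ : _ `&` _ = `]p, t[%classic).
    by rewrite lebesgue_measure_itv/= lte_fin pt -EFinB.
  apply/seteqP; split => [x [/=]|x /=]; rewrite !in_itv/=.
    by move=> /andP[-> _] ->.
  by move=> /andP[-> xt]; split => //; rewrite (le_trans (ltW xt)).
rewrite mulr1 (_ : _ `&` _ = `]p, q]%classic).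
  rewrite lebesgue_measure_itv/= lte_fin.
  have [_|] := ltP p q; first by rewrite -EFinB; congr EFin; ring.
  move=> qp; have -> : p = q by lra.
  by congr EFin; ring.
apply/seteqP; split => [x [/=]//|x /=]; rewrite !in_itv/= => /andP[px xq].
by rewrite px xq (le_lt_trans xq).
Qed.

(** Integration by parts for a merely integrable f: the bump is an integral of indicators of s < t,
    and after exchanging the integrals the inner one is that of f over ]s, +oo[. *)
Lemma fubini_ramp f (p q : R) : p <= q -> leb.-integrable setT (EFin \o f) ->
  \int[leb]_t (f t * bump ramp p q t) =
  \int[leb]_(s in `]p, q]) (\int[leb]_t f t - primitive f s).
Proof.
move=> pq If.
have mf : measurable_fun setT f by apply/measurable_EFinP; exact: measurable_int If.
pose h (z : R * R) : R := f z.1 * (\1_`]p, q] z.2 * \1_[set z : R * R | z.2 < z.1] z).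
have mlt : measurable [set z : R * R | z.2 < z.1].
  rewrite -[X in measurable X]setTI.
  have := @measurable_fun_ltr _ _ R setT (fun z : R * R => z.2) (fun z : R * R => z.1)
    measurable_snd measurable_fst measurableT [set true].
  by rewrite (_ : _ @^-1` [set true] = [set z : R * R | z.2 < z.1])//; apply.
have mh : measurable_fun setT (EFin \o h).
  apply/measurable_EFinP; apply: measurable_funM.
    by apply: measurableT_comp => //; exact: measurable_fst.
  apply: measurable_funM; last exact: measurable_indic.
  by apply: measurableT_comp; [exact: measurable_indic|exact: measurable_snd].
have inner t : (\int[leb]_s (\1_`]p, q] s * \1_[set z : R * R | z.2 < z.1] (t, s))%:E =
    (bump ramp p q t)%:E)%E.
  rewrite -measure_itv_below// -[X in leb X]setIT -integral_indic//; last exact: measurableI.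
  apply: eq_integral => s _; rewrite indicI/=; congr (_ * _)%:E.
have iI : leb.-integrable setT (EFin \o \1_`]p, q]) by exact: integrable_indic_itv.
have iA t : leb.-integrable setT
    (EFin \o (fun s => \1_`]p, q] s * \1_[set z : R * R | z.2 < z.1] (t, s))).
  apply: le_integrable iI => //.
    rewrite (_ : (fun s => _) = \1_(`]p, q] `&` `]-oo, t[)); last by rewrite indicI.
    by apply/measurable_EFinP/measurable_indic; exact: measurableI.
  move=> s _; rewrite lee_fin normrM ler_piMr// !indicE.
  by case: (_ \in [set z : R * R | _]); rewrite ?normr0 ?normr1.
have in_s t : (\int[leb]_s (h (t, s))%:E = (f t * bump ramp p q t)%:E)%E.
  rewrite EFinM -(inner t).
  have := integralZl measurableT (iA t) (f t) => <-.
  by apply: eq_integral => s _; rewrite /= -EFinM.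
(* Dropping the indicator of s < t leaves the product majorant |f(t)| 1_]p, q](s), whose integral is
   finite. *)
have hint : (leb \x leb)%E.-integrable setT (EFin \o h).
  pose h' (z : R * R) : R := `|f z.1| * \1_`]p, q] z.2.
  have mh' : measurable_fun setT (EFin \o h').
    apply/measurable_EFinP; apply: measurable_funM.
      apply: measurableT_comp => //.
      by apply: measurableT_comp => //; exact: measurable_fst.
    by apply: measurableT_comp; [exact: measurable_indic|exact: measurable_snd].
  suff : (leb \x leb)%E.-integrable setT (EFin \o h').
    apply: le_integrable => // z _; rewrite lee_fin /h /h' !normrM normr_id.
    rewrite ler_wpM2l// ler_piMr// !indicE.
    by case: (_ \in [set z : R * R | _]); rewrite ?normr0 ?normr1.
  apply/integrable12ltyP => //.
  have /integrableP[_] := integrableZl measurableT (fine (leb `]p, q])) (integrable_norm If).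
  congr (_ < _)%E; apply: eq_integral => t _.
  rewrite /h' abse_EFin (_ : `|_| = `|f t| * fine (leb `]p, q])); last first.
    by rewrite normrM normr_id mulrC ger0_norm// fine_ge0.
  transitivity (`|f t|%:E * \int[leb]_s (\1_`]p, q] s)%:E)%E.
    rewrite integral_indic// setIT EFinM fineK//.
    by rewrite lebesgue_measure_itv/=; case: ifP.
  rewrite -(integralZl measurableT iI); apply: eq_integral => s _.
  by rewrite /= -EFinM normrM normr_id [in RHS]ger0_norm.
have lt1 (s t : R) : \1_[set z : R * R | z.2 < z.1] (t, s) = (s < t)%R%:R :> R.
  by rewrite indicE; congr (nat_of_bool _)%:R; apply/idP/idP; rewrite inE.
have in_t s : (\int[leb]_t (h (t, s))%:E =
    (\1_`]p, q] s * (\int[leb]_t f t - primitive f s))%:E)%E.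
  have Is : leb.-integrable `]s, +oo[ (EFin \o f) by apply: integrableS If.
  have -> : \int[leb]_t f t - primitive f s = \int[leb]_(t in `]s, +oo[) f t.
    rewrite /primitive -set_itvNyy Rintegral_itvB//.
    by apply: integrableS If.
  rewrite EFinM fineK; last exact: integrable_fin_num.
  rewrite [in RHS]integral_mkcond.
  have Ir : leb.-integrable setT ((EFin \o f) \_ `]s, +oo[).
    by apply/integrable_restrict => //; rewrite setTI.
  rewrite -(integralZl measurableT Ir); apply: eq_integral => t _.
  rewrite patchE mem_setE in_itv/= andbT /h /= lt1.
  by case: ifP => _ /=; rewrite ?mulr0 ?mule0// mulr1 -EFinM mulrC.
have Fub := Fubini hint.
rewrite /Rintegral.
transitivity (fine (\int[leb]_t \int[leb]_s (EFin \o h) (t, s))%E).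
  by congr fine; apply: eq_integral => t _; rewrite /= in_s.
rewrite Fub [in RHS]integral_mkcond; congr fine; apply: eq_integral => s _.
rewrite [LHS]in_t patchE indicE; case: ifP => _; by rewrite ?mul1r ?mul0r.
Qed.
Lemma Rintegral_bump_heaviside f (p q : R) : p <= q ->
  \int[leb]_t (f t * bump heaviside p q t) = \int[leb]_(t in `]p, q]) f t.
Proof.
move=> pq; rewrite [RHS]Rintegral_mkcond; apply: eq_Rintegral => t _.
by rewrite bump_heavisideE// patchE indicE; case: ifP => _; rewrite ?mulr1 ?mulr0.
Qed.

Lemma integrable_bump_heaviside f (p q : R) : p <= q ->
  leb.-integrable setT (EFin \o f) ->
  leb.-integrable setT (EFin \o (fun t => f t * bump heaviside p q t)).
Proof.
move=> pq If; have : leb.-integrable setT ((EFin \o f) \_ `]p, q]).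
  by apply/integrable_restrict => //; rewrite setTI; apply: integrableS If.
apply: eq_integrable => // t _ /=.
by rewrite bump_heavisideE// patchE indicE; case: ifP => _; rewrite ?mulr1 ?mulr0.
Qed.

Lemma bump_ramp_itv (p q t : R) : p <= q -> 0 <= bump ramp p q t <= q - p.
Proof.
move=> pq; rewrite /bump /ramp /heaviside !subr_gt0.
by case: (ltP p t) => pt; case: (ltP q t) => qt; rewrite ?mulr1 ?mulr0; lra.
Qed.

Lemma measurable_bump_ramp (p q : R) : measurable_fun setT (bump ramp p q).
Proof.
have mr c : measurable_fun setT (fun t : R => ramp (t - c)).
  rewrite (_ : (fun t : R => _) = (fun t : R => (t - c) * \1_`]c, +oo[ t)).
    apply: measurable_funM; last exact: measurable_indic.
    exact: measurable_funB.
  apply/funext => t; rewrite /ramp /heaviside indicE mem_setE in_itv/= andbT.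
  by rewrite subr_gt0.
exact: measurable_funB.
Qed.

Lemma integrable_bump_ramp f (p q : R) : p <= q ->
  leb.-integrable setT (EFin \o f) ->
  leb.-integrable setT (EFin \o (fun t => f t * bump ramp p q t)).
Proof.
move=> pq If.
have mf : measurable_fun setT f by apply/measurable_EFinP; exact: measurable_int If.
have := integrableZl measurableT (q - p) If; apply: le_integrable => //.
  apply/measurable_EFinP; apply: measurable_funM => //.
  exact: measurable_bump_ramp.
move=> t _; rewrite /= lee_fin !normrM mulrC ler_wpM2r//.
have /andP[b0 bqp] := bump_ramp_itv t pq.
by rewrite !ger0_norm// subr_ge0.
Qed.

Lemma Rintegral_trap (h : R -> R) f (A B b : R) :
  (forall p q, p <= q -> leb.-integrable setT (EFin \o (fun t => f t * bump h p q t))) ->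
  A <= b <= B ->
  \int[leb]_t (f t * trap h A B b t) =
  (B - A) * \int[leb]_t (f t * bump h A b t) - (b - A) * \int[leb]_t (f t * bump h A B t).
Proof.
move=> Ib /andP[Ab bB].
have I1 := Ib _ _ Ab; have I2 := Ib _ _ (le_trans Ab bB).
rewrite -!RintegralZl//.
rewrite -RintegralB//; last 2 first.
- by have := integrableZl measurableT (B - A) I1; apply: eq_integrable.
- by have := integrableZl measurableT (b - A) I2; apply: eq_integrable.
by apply: eq_Rintegral => t _; rewrite /trap; ring.
Qed.

(* The tests say that g + (int f - primitive f) has constant mean over the
   intervals ]A, r], so g is a.e. equal to a function G with G' = f a.e.; G is
   nonnegative, so its zeros are minima. *)
Lemma ae_weak_derivative_eq0 f g (A B : R) : A < B ->
  leb.-integrable setT (EFin \o g) -> leb.-integrable setT (EFin \o f) ->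
  (forall t, 0 <= g t) ->
  (forall r : rat, A < ratr r < B ->
    \int[leb]_t (g t * trap heaviside A B (ratr r) t) =
    - \int[leb]_t (f t * trap ramp A B (ratr r) t)) ->
  {ae leb, forall t, A < t < B -> g t = 0 -> f t = 0}.
Proof.
move=> AB Ig If g0 weak.
set I := \int[leb]_t f t.
pose k t := g t + (I - primitive f t).
have cT : continuous (fun t => I - primitive f t).
  by move=> t; apply: cvgB; [exact: cvg_cst|exact: primitive_continuous].
have ITc : leb.-integrable `[A, B] (EFin \o (fun t => I - primitive f t)).
  apply: continuous_compact_integrable; first exact: segment_compact.
  exact: continuous_subspaceT.
have IT : leb.-integrable `]A, B] (EFin \o (fun t => I - primitive f t)).
  apply: integrableS ITc => //.
  by move=> x /=; rewrite !in_itv/= => /andP[/ltW -> ->].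
have Ik : leb.-integrable `]A, B] (EFin \o k).
  have Ig' : leb.-integrable `]A, B] (EFin \o g) by apply: integrableS Ig.
  rewrite (_ : _ \o k = (EFin \o g) \+ (EFin \o (fun t => I - primitive f t)))//.
  exact: integrableD.
pose k' := k \_ `]A, B].
have Ik' : leb.-integrable setT (EFin \o k').
  by rewrite /k' -restrict_EFin; apply/integrable_restrict => //; rewrite setTI.
pose c := \int[leb]_(t in `]A, B]) k t.
have k'E b : b <= B -> primitive k' b = \int[leb]_(t in `]A, b]) k t.
  move=> bB; rewrite /primitive /k' -Rintegral_mkcondr; congr (Rintegral _ _ _).
  apply/seteqP; split => [x [/=]|x /=]; rewrite !in_itv/=.
    by move=> xb /andP[-> _].
  by move=> /andP[-> xb]; rewrite xb (le_trans xb bB).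
(* The weak identity at r, with [fubini_ramp] applied to its right-hand side, becomes a relation
   between integrals of k over ]A, r] and ]A, B]. *)
have linQ (r : rat) : A < ratr r < B ->
    (B - A) * primitive k' (ratr r) = (ratr r - A) * c.
  move=> rAB; have /andP[/ltW Ar /ltW rB] := rAB.
  have ArB : A <= ratr r <= B by rewrite Ar rB.
  have := weak r rAB.
  rewrite Rintegral_trap//; last by move=> p q pq; exact: integrable_bump_heaviside.
  rewrite Rintegral_trap//; last by move=> p q pq; exact: integrable_bump_ramp.
  rewrite !Rintegral_bump_heaviside ?fubini_ramp ?(le_trans Ar)// ?ltW//.
  have split_k b : b <= B -> \int[leb]_(t in `]A, b]) k t =
      \int[leb]_(t in `]A, b]) g t + \int[leb]_(s in `]A, b]) (I - primitive f s).
    move=> bB; rewrite -RintegralD//; first by apply: integrableS Ig.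
    apply: integrableS IT => //.
    by apply: subset_itvl; rewrite bnd_simp.
  by rewrite k'E// /c !split_k// -/I => H; lra.
(* Both sides are continuous in b, so agreement at rational points suffices. *)
have lin b : A < b < B -> (B - A) * primitive k' b = (b - A) * c.
  move=> /andP[Ab bB]; apply/eqP; rewrite -subr_eq0; apply/negPn/negP => D0.
  pose D y := (B - A) * primitive k' y - (y - A) * c.
  have cD : {for b, continuous D}.
    apply: cvgB; first by apply: cvgM; [exact: cvg_cst|exact: primitive_continuous].
    by apply: cvgM; [apply: cvgB; [exact: cvg_id|exact: cvg_cst]|exact: cvg_cst].
  have : \forall y \near b, (D y != 0) && (A < y < B).
    near=> y; apply/andP; split; last first.
      by apply/andP; split; near: y; [exact: lt_nbhsr|exact: lt_nbhsl].
    near: y; have := cD [set z | z != 0]; apply.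
    by apply: open_nbhs_nbhs; split => //; exact: open_neq.
  move=> /nbhs_ballP[e /= e0 be].
  have /rat_in_itvoo[r] : b < b + e by rewrite ltrDl.
  rewrite in_itv/= => /andP[br rbe].
  have /be /andP[+ rAB] : ball b e (ratr r : R).
    by rewrite /ball/= ltr_norml; lra.
  by rewrite /D linQ// subrr eqxx.
pose G t := c / (B - A) - (I - primitive f t).
have gG : {ae leb, forall t, A < t < B -> g t = G t}.
  have := ae_is_derive_primitive Ik'.
  apply: filterS; first exact: (ae_filter_ringOfSetsType leb).
  move=> t dk tAB.
  (* Near t the primitive of k is affine with slope c / (B - A); at almost every t its derivative is
     also k(t), which determines g(t). *)
  have nearlin : \forall y \near t, (y - A) * (c / (B - A)) = primitive k' y.
    have /andP[At tB] := tAB.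
    near=> y; have yAB : A < y < B.
      by apply/andP; split; near: y; [exact: lt_nbhsr|exact: lt_nbhsl].
    apply: (@mulfI _ (B - A)); first by rewrite subr_eq0 gt_eqF.
    rewrite lin// mulrCA; congr (_ * _).
    by rewrite mulrC divfK// subr_eq0 gt_eqF.
  have dl : is_derive t (1 : R) (fun y => (y - A) * (c / (B - A))) (c / (B - A)).
    have := is_deriveM (is_deriveB (is_derive_id t (1:R)) (is_derive_cst A t (1:R)))
      (is_derive_cst (c / (B - A)) t (1:R)).
    by rewrite scaler0 add0r subr0 [_ *: 1]mulr1.
  have dl' := near_eq_is_derive nearlin dl.
  have k'c : k' t = c / (B - A).
    by have [_ <-] := dk; have [_ <-] := dl'.
  move: k'c; rewrite /k' patchE ifT; last first.
    by rewrite mem_setE in_itv/=; have /andP[-> /ltW ->] := tAB.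
  by rewrite /k /G => <-; rewrite addrK.
have cG : continuous G.
  by move=> t; apply: cvgB; [exact: cvg_cst|exact: cT].
(* If G were negative at t, it would be negative on an interval, which contains points where G
   equals g >= 0. *)
have G0 t : A < t < B -> 0 <= G t.
  move=> /andP[At tB]; rewrite leNgt; apply/negP => Gt.
  have : \forall y \near t, (G y < 0) && (A < y < B).
    near=> y; apply/andP; split; last first.
      by apply/andP; split; near: y; [exact: lt_nbhsr|exact: lt_nbhsl].
    by near: y; apply: (cG t [set z | z < 0]); apply: lt_nbhsl.
  move=> /nbhs_ballP[e /= e0 te].
  have tte : t < t + e by rewrite ltrDl.
  have [y /andP[ty yte] gy] := ae_exists_itv tte gG.
  have /te /andP[Gy yAB] : ball t e y by rewrite /ball/= ltr_norml; lra.
  by move: Gy; rewrite -gy// ltNge g0.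
apply: (filterS2 _ _ gG (ae_is_derive_primitive If)).
  exact: (ae_filter_ringOfSetsType leb).
move=> t gGt df tAB gt0.
have dG : is_derive t (1 : R) G (f t).
  (* Puts f(t) in the form 0 - (0 - f(t)), the derivative of G read off its definition. *)
  rewrite -[f t]add0r -[f t]opprK -[- f t]sub0r.
  exact: is_deriveB.
apply: (is_derive_local_min dG).
have /andP[At tB] := tAB.
near=> y; rewrite -gGt// gt0; apply: G0.
by apply/andP; split; near: y; [exact: lt_nbhsr|exact: lt_nbhsl].
Unshelve. all: by end_near. Qed.

End real_line.

(** * Reduction to lines *)

Section slicing.
Context {R : realType} {m : nat}.
Variable i : 'I_m.+1.
Local Notation leb := (@lebesgue_measure R).
Local Notation mu := (lebesgue_rV R m).
Local Notation muS := (lebesgue_rV R m.+1).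
Local Notation prodmu := (leb \x mu)%E.

Let push : {measure set 'rV[R]_m.+1 -> \bar R} :=
  measure_function_pushforward__canonical__measure_function_Measure
    prodmu (@measurable_rV_ins R m i).

Let integral_push (h : 'rV[R]_m.+1 -> \bar R) :
  (\int[muS]_x h x = \int[push]_x h x)%E.
Proof. by apply: eq_measure_integral => A mA _; exact: lebesgue_rV_ins. Qed.

Lemma integrable_rV_ins (h : 'rV[R]_m.+1 -> \bar R) :
  muS.-integrable setT h -> prodmu.-integrable setT (h \o rV_ins i).
Proof.
move=> Ih; have mh := measurable_int _ Ih.
apply/integrableP; split.
  exact: (measurableT_comp mh (measurable_rV_ins i)).
have /integrableP[_] := Ih; rewrite integral_push.
rewrite ge0_integral_pushforward//; last exact: measurableT_comp.
exact: measurable_rV_ins.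
Qed.

Lemma integral_rV_ins (h : 'rV[R]_m.+1 -> \bar R) : muS.-integrable setT h ->
  (\int[muS]_x h x = \int[prodmu]_z h (rV_ins i z))%E.
Proof.
move=> Ih; rewrite integral_push integral_pushforward//.
- exact: measurable_rV_ins.
- exact: measurable_int Ih.
- exact: integrable_rV_ins.
Qed.

Lemma ge0_integral_rV_ins (h : 'rV[R]_m.+1 -> \bar R) :
  measurable_fun setT h -> (forall x, 0 <= h x)%E ->
  (\int[muS]_x h x = \int[mu]_y \int[leb]_t h (rV_ins i (t, y)))%E.
Proof.
move=> mh h0; rewrite integral_push ge0_integral_pushforward//; last first.
  exact: measurable_rV_ins.
rewrite preimage_setT; have mhi : measurable_fun setT (h \o rV_ins i).
  exact: (measurableT_comp mh (measurable_rV_ins i)).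
by rewrite [LHS](@fubini_tonelli2 _ _ _ _ _ leb mu (h \o rV_ins i) mhi (fun z => h0 _)).
Qed.

Lemma tensor_ins (psi : 'I_m.+1 -> R -> R) t y :
  tensor psi (rV_ins i (t, y)) = psi i t * tensor (fun k => psi (lift i k)) y.
Proof.
rewrite /tensor (bigD1_ord i)//= rV_ins_i; congr (_ * _).
by apply: eq_bigr => k _; rewrite rV_ins_lift.
Qed.

Lemma tensor_bump_heaviside n (p q : 'rV[R]_n) x : (forall k, p ord0 k <= q ord0 k) ->
  tensor (fun k => bump heaviside (p ord0 k) (q ord0 k)) x = \1_(rV_box p q) x.
Proof.
move=> pq; rewrite indicE /tensor; have [xpq|/asboolP/existsNP[k xk]] := boolP (x \in rV_box p q).
  rewrite big1// => k _; rewrite bump_heavisideE// indicE mem_setE.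
  by move: xpq; rewrite inE => ->.
rewrite (bigD1 k)//= bump_heavisideE// indicE mem_setE.
by move/negP/negbTE : xk => ->; rewrite mul0r.
Qed.

Lemma measurable_trap (h : R -> R) (A B b : R) :
  (forall p q, p <= q -> measurable_fun setT (bump h p q)) -> A <= b <= B ->
  measurable_fun setT (trap h A B b).
Proof.
move=> mh /andP[Ab bB]; apply: measurable_funB; apply: measurable_funM => //; apply: mh => //.
exact: le_trans bB.
Qed.

Lemma measurable_bump_heaviside (p q : R) : p <= q ->
  measurable_fun setT (bump heaviside p q).
Proof.
move=> pq; rewrite (_ : bump _ _ _ = \1_`]p, q]); first exact: measurable_indic.
by apply/funext => t; rewrite bump_heavisideE.
Qed.

Lemma integrable_boundedM d (T : measurableType d) (nu : {measure set T -> \bar R})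
    (U : set T) (h k : T -> R) (M : R) :
  nu.-integrable U (EFin \o h) -> measurable U -> measurable_fun U k ->
  (forall x, `|k x| <= M) -> nu.-integrable U (EFin \o (fun x => h x * k x)).
Proof.
move=> Ih mU mk kM; have mh : measurable_fun U h.
  by apply/measurable_EFinP; exact: measurable_int Ih.
have := integrableZl mU M Ih; apply: le_integrable => //.
  by apply/measurable_EFinP; exact: measurable_funM.
move=> x _; rewrite /= lee_fin !normrM mulrC ler_wpM2r//.
exact: le_trans (kM x) (ler_norm _).
Qed.

(** Fubini turns the hypothesis into the vanishing of box integrals of y |-> int k(t, y) dt, to
    which [ae_eq0_of_box_integral] applies. *)
Lemma ae_slices_eq0 (k : R * 'rV[R]_m -> R) (P Q : 'rV[R]_m) :
  prodmu.-integrable setT (EFin \o k) ->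
  (forall p q : 'rV[R]_m, (forall j, P ord0 j <= p ord0 j) ->
    (forall j, p ord0 j < q ord0 j) -> (forall j, q ord0 j <= Q ord0 j) ->
    (\int[prodmu]_z (k z * \1_(rV_box p q) z.2)%:E = 0)%E) ->
  {ae mu, forall y, rV_box P Q y -> (\int[leb]_t (k (t, y))%:E = 0)%E}.
Proof.
move=> Ik k0; have mk := measurable_int _ Ik.
have mk' : measurable_fun setT k by exact/measurable_EFinP.
have mG : measurable_fun setT (fubini_G leb (abse \o (EFin \o k))).
  have mak : measurable_fun setT (abse \o (EFin \o k)) by exact: measurableT_comp.
  have := @measurable_fun_fubini_tonelli_G _ _ _ _ _ leb (abse \o (EFin \o k)) mak.
  by apply=> z; exact: abse_ge0.
have IG : mu.-integrable setT (fubini_G leb (EFin \o k)).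
  apply/integrableP; split; first exact: measurable_fubini_G Ik.
  have := (integrable21ltyP leb mu mk).1 Ik; apply: le_lt_trans.
  apply: ge0_le_integral => //.
  - by apply: measurableT_comp => //; exact: measurable_fubini_G Ik.
  - move=> y _; apply: le_abse_integral => //.
    exact: (@measurable_fun_pair1 _ _ _ _ _ _ (EFin \o k) y mk).
apply: (@ae_eq0_of_box_integral _ _ P Q (fubini_G leb (EFin \o k))).
  by apply: integrableS IG => //; exact: measurable_rV_box.
move=> p q Pp pq qQ.
have Ikb : prodmu.-integrable setT (EFin \o (fun z => k z * \1_(rV_box p q) z.2)).
  apply: le_integrable Ik => //.
    apply/measurable_EFinP; apply: measurable_funM => //.
    apply: measurableT_comp; last exact: measurable_snd.
    by apply: measurable_indic; exact: measurable_rV_box.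
  move=> z _; rewrite /= lee_fin normrM ler_piMr// indicE.
  by case: (_ \in _); rewrite ?normr1 ?normr0.
rewrite -(k0 p q)// -(integral21_prod_meas1 Ikb) integral_mkcond.
apply: eq_integral => y _; rewrite patchE /fubini_G.
case: ifPn => yb.
  by apply: eq_integral => t _ /=; rewrite indicE yb mulr1.
rewrite -[LHS](integral0 leb setT).
by apply: eq_integral => t _ /=; rewrite indicE (negbTE yb) mulr0.
Qed.

Lemma null_of_ae_null_slices (S : set (R * 'rV[R]_m)) : measurable S ->
  {ae mu, forall y, {ae leb, forall t, ~ S (t, y)}} -> prodmu S = 0%E.
Proof.
move=> mS aeS.
have mI : measurable_fun setT (EFin \o (\1_S : R * 'rV[R]_m -> R)).
  by apply/measurable_EFinP; exact: measurable_indic.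
rewrite -[S]setIT -integral_indic//.
have mG : measurable_fun setT (fubini_G leb (EFin \o (\1_S : R * 'rV[R]_m -> R))).
  have := @measurable_fun_fubini_tonelli_G _ _ _ _ _ leb (EFin \o \1_S) mI.
  by apply=> z; rewrite lee_fin.
transitivity (\int[mu]_y fubini_G leb (EFin \o (\1_S : R * 'rV[R]_m -> R)) y)%E.
  have := @fubini_tonelli2 _ _ _ _ _ leb mu (EFin \o \1_S) mI.
  by apply=> z; rewrite lee_fin.
transitivity (\int[mu]_y cst 0 y)%E; last exact: integral0.
apply: ae_eq_integral => //.
apply: filterS aeS => y aey _.
transitivity (\int[leb]_t cst 0 t)%E; last exact: integral0.
apply: ae_eq_integral => //.
  exact: (@measurable_fun_pair1 _ _ _ _ _ _ (EFin \o \1_S) y mI).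
apply: (filterS _ aey); first exact: (ae_filter_ringOfSetsType leb).
by move=> t nS _ /=; rewrite indicE memNset.
Qed.

Lemma trap_heaviside_le (A B b t : R) : A <= b <= B ->
  `|trap heaviside A B b t| <= 4 * (B - A) * 1.
Proof.
have h1 s : `|heaviside s| <= 1 :> R.
  by rewrite /heaviside; case: ltP => _; rewrite ?normr1 ?normr0.
by move=> AbB; apply: trap_bound.
Qed.

Lemma trap_ramp_le (A B b t : R) : A <= b <= B ->
  `|trap ramp A B b t| <= (B - A) * (b - A) + (b - A) * (B - A).
Proof.
move=> /andP[Ab bB]; have /andP[b0 b1] := bump_ramp_itv t Ab.
have /andP[c0 c1] := bump_ramp_itv t (le_trans Ab bB).
rewrite /trap (le_trans (ler_normB _ _))// !normrM.
by apply: lerD; apply: ler_pM => //; rewrite ger0_norm//; lra.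
Qed.

Lemma measurable_tensor n (psi : 'I_n -> R -> R) :
  (forall j, measurable_fun setT (psi j)) -> measurable_fun setT (tensor psi).
Proof.
move=> mpsi; apply: measurable_prod => j _.
by apply: measurableT_comp => //; exact: measurable_rV_coord.
Qed.

(** Both sides of the trapezoid identity gathered into one integrand: its integral over a line
    vanishes exactly when the one-dimensional weak identity holds there, for integrable slices. *)
Definition slice_test (G H : R * 'rV[R]_m -> R) (A B b : R) (z : R * 'rV[R]_m) : R :=
  G z * trap heaviside A B b z.1 + H z * trap ramp A B b z.1.

Lemma integrable_slice_test G H A B b : A <= b <= B ->
  prodmu.-integrable setT (EFin \o G) -> prodmu.-integrable setT (EFin \o H) ->
  prodmu.-integrable setT (EFin \o slice_test G H A B b).
Proof.
move=> AbB IG IH.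
have mth : measurable_fun setT (fun z : R * 'rV[R]_m => trap heaviside A B b z.1).
  apply: (@measurableT_comp _ _ _ _ _ _ (trap heaviside A B b)); last exact: measurable_fst.
  by apply: measurable_trap => // *; exact: measurable_bump_heaviside.
have mtr : measurable_fun setT (fun z : R * 'rV[R]_m => trap ramp A B b z.1).
  apply: (@measurableT_comp _ _ _ _ _ _ (trap ramp A B b)); last exact: measurable_fst.
  by apply: measurable_trap => // *; exact: measurable_bump_ramp.
have I1 := integrable_boundedM IG measurableT mth (fun z => trap_heaviside_le z.1 AbB).
have I2 := integrable_boundedM IH measurableT mtr (fun z => trap_ramp_le z.1 AbB).
exact: (integrableD _ I1 I2).
Qed.

Lemma integral_slice_test (U : set 'rV[R]_m.+1) (g f : 'rV[R]_m.+1 -> R)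
    (P Q : 'rV[R]_m.+1) (d b : R) (p q : 'rV[R]_m) :
  open U ->
  muS.-integrable U (EFin \o g) -> muS.-integrable U (EFin \o f) ->
  (forall phi, Cc_smooth U phi ->
    \int[muS]_(x in U) (g x * partial i phi x) = - \int[muS]_(x in U) (f x * phi x)) ->
  0 < d ->
  [set x : 'rV[R]_m.+1 | forall j, x ord0 j \in `[P ord0 j, Q ord0 j + d]] `<=` U ->
  P ord0 i < Q ord0 i ->
  P ord0 i <= b <= Q ord0 i ->
  (forall j, rV_del i P ord0 j <= p ord0 j) -> (forall j, p ord0 j < q ord0 j) ->
  (forall j, q ord0 j <= rV_del i Q ord0 j) ->
  (\int[prodmu]_z (slice_test ((g \_ U) \o rV_ins i) ((f \_ U) \o rV_ins i)
      (P ord0 i) (Q ord0 i) b z * \1_(rV_box p q) z.2)%:E = 0)%E.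
Proof.
move=> oU Ig If weak d0 PQU PQ PbQ Pp pq qQ.
have mU := rV_open_measurable oU.
set A := P ord0 i; set B := Q ord0 i.
(* The i-th entries serve to keep the corners ordered; in the test function that factor is
   overwritten by the trapezoid. *)
pose p1 := rV_ins i (A, p); pose q1 := rV_ins i (B, q).
have Pp1 j : P ord0 j <= p1 ord0 j.
  by case: (unliftP i j) => [k ->|->]; rewrite ?rV_ins_i// rV_ins_lift; have := Pp k; rewrite mxE.
have pq1 j : p1 ord0 j < q1 ord0 j.
  by case: (unliftP i j) => [k ->|->]; rewrite ?rV_ins_i// !rV_ins_lift.
have qQ1 j : q1 ord0 j <= Q ord0 j.
  by case: (unliftP i j) => [k ->|->]; rewrite ?rV_ins_i// rV_ins_lift; have := qQ k; rewrite mxE.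
have := weak_trapezoid d0 oU Ig If weak PQU Pp1 pq1 qQ1 PbQ.
rewrite -/A -/B; pose psi h := update (fun j => bump heaviside (p1 ord0 j) (q1 ord0 j)) i
  (trap h A B b).
move=> /=; rewrite -/(psi heaviside) -/(psi ramp).
have tens h z : tensor (psi h) (rV_ins i z) = trap h A B b z.1 * \1_(rV_box p q) z.2.
  case: z => t y; rewrite tensor_ins /psi /update eqxx; congr (_ * _).
  rewrite -tensor_bump_heaviside; last by move=> k; exact/ltW.
  congr tensor; apply/funext => k; rewrite eq_sym (negbTE (neq_lift _ _)).
  by rewrite /p1 /q1 !rV_ins_lift.
have transfer h k (M : R) : measurable_fun setT (trap h A B b) ->
    (forall t, `|trap h A B b t| <= M) -> muS.-integrable U (EFin \o k) ->
    prodmu.-integrable setT (EFin \o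
      (fun z => (k \_ U) (rV_ins i z) * (trap h A B b z.1 * \1_(rV_box p q) z.2))) /\
    \int[muS]_(x in U) (k x * tensor (psi h) x) =
    \int[prodmu]_z ((k \_ U) (rV_ins i z) * (trap h A B b z.1 * \1_(rV_box p q) z.2)).
  move=> mt tM Ik.
  have IkU : muS.-integrable setT (EFin \o (k \_ U)).
    by rewrite -restrict_EFin; apply/integrable_restrict => //; rewrite setTI.
  have mpsi j : measurable_fun setT (psi h j).
    rewrite /psi /update; case: ifP => _ //.
    by apply: measurable_bump_heaviside; exact/ltW.
  have bpsi j t : `|psi h j t| <= Num.max M 1.
    rewrite /psi /update; case: ifP => _; rewrite le_max ?tM//.
    rewrite bump_heavisideE; last exact/ltW.
    by rewrite indicE; case: (_ \in _); rewrite ?normr1 ?normr0 ?lexx ?ler01 orbT.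
  have Ikt := integrable_boundedM IkU measurableT (measurable_tensor mpsi)
    (fun x => tensor_bound x bpsi).
  split.
    have := integrable_rV_ins Ikt; apply: eq_integrable => // z _ /=.
    by rewrite tens.
  rewrite Rintegral_mkcond /Rintegral; congr fine.
  transitivity (\int[muS]_x (EFin \o (fun x => (k \_ U) x * tensor (psi h) x)%R) x)%E.
    apply: eq_integral => x _ /=; congr EFin; rewrite !patchE.
    by case: ifP => _; rewrite ?mul0r.
  rewrite integral_rV_ins//; apply: eq_integral => z _ /=.
  by rewrite tens.
have mH : measurable_fun setT (trap heaviside A B b).
  by apply: measurable_trap => // *; exact: measurable_bump_heaviside.
have mR : measurable_fun setT (trap ramp A B b).
  by apply: measurable_trap => // *; exact: measurable_bump_ramp.
have [I1 ->] := transfer _ _ _ mH (fun t => trap_heaviside_le t PbQ) Ig.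
have [I2 ->] := transfer _ _ _ mR (fun t => trap_ramp_le t PbQ) If.
move=> E12; rewrite -[LHS]fineK.
  congr EFin; apply/eqP; rewrite -[X in X == _]/(Rintegral _ _ _).
  move/eqP : E12; rewrite -addr_eq0 -RintegralD// => /eqP <-; apply/eqP.
  by apply: eq_Rintegral => z _; rewrite /slice_test/=; ring.
apply: integrable_fin_num => //.
have := integrableD _ I1 I2 => /(_ _)/eq_integrable; apply => // z _ /=.
by rewrite /slice_test -EFinD/=; congr EFin; ring.
Qed.

Lemma ae_partial_eq0_box (U : set 'rV[R]_m.+1) (g f : 'rV[R]_m.+1 -> R)
    (P Q : 'rV[R]_m.+1) (d : R) :
  open U ->
  muS.-integrable U (EFin \o g) -> muS.-integrable U (EFin \o f) ->
  (forall x, U x -> 0 <= g x) ->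
  (forall phi, Cc_smooth U phi ->
    \int[muS]_(x in U) (g x * partial i phi x) = - \int[muS]_(x in U) (f x * phi x)) ->
  0 < d ->
  [set x : 'rV[R]_m.+1 | forall j, x ord0 j \in `[P ord0 j, Q ord0 j + d]] `<=` U ->
  {ae muS, forall x : 'rV[R]_m.+1,
    (forall j, P ord0 j < x ord0 j < Q ord0 j) -> g x = 0 -> f x = 0}.
Proof.
move=> oU Ig If g0 weak d0 PQU.
have mU := rV_open_measurable oU.
have [PQ|QP] := ltP (P ord0 i) (Q ord0 i); last first.
  apply: aeW => x /(_ i) /andP[Px xQ].
  by have := lt_le_trans (lt_trans Px xQ) QP; rewrite ltxx.
pose A := P ord0 i; pose B := Q ord0 i.
pose gU := g \_ U; pose fU := f \_ U.
have IgU : muS.-integrable setT (EFin \o gU).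
  by rewrite /gU -restrict_EFin; apply/integrable_restrict => //; rewrite setTI.
have IfU : muS.-integrable setT (EFin \o fU).
  by rewrite /fU -restrict_EFin; apply/integrable_restrict => //; rewrite setTI.
have gU0 x : 0 <= gU x.
  by rewrite /gU patchE; case: ifPn => //; rewrite inE; exact: g0.
have IG := integrable_rV_ins IgU.
have IH := integrable_rV_ins IfU.
pose G := gU \o rV_ins i; pose H := fU \o rV_ins i.
pose P' := rV_del i P; pose Q' := rV_del i Q.
have slices_r (r : rat) : {ae mu, forall y, rV_box P' Q' y -> A < ratr r < B ->
    (\int[leb]_t (slice_test G H A B (ratr r) (t, y))%:E = 0)%E}.
  have [rAB|nrAB] := boolP (A < ratr r < B); last exact: aeW.
  have rAB' : A <= ratr r <= B by have /andP[/ltW -> /ltW ->] := rAB.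
  have boxes p q := @integral_slice_test U g f P Q d (ratr r) p q oU Ig If weak d0 PQU PQ rAB'.
  apply: (filterS _ (ae_slices_eq0 (integrable_slice_test rAB' IG IH) boxes)).
  by move=> y Hy Py _; exact: Hy.
(* Enumerating the rationals by [unpickle] gives one null set of y valid for all break points at
   once. *)
have slices : {ae mu, forall y, forall n : nat, rV_box P' Q' y ->
    forall r : rat, unpickle n = Some r -> A < ratr r < B ->
    (\int[leb]_t (slice_test G H A B (ratr r) (t, y))%:E = 0)%E}.
  apply: ae_foralln => n; case En : (unpickle n : option rat) => [r|]; last exact: aeW.
  by apply: filterS (slices_r r) => y Hy Py _ [<-]; exact: Hy.
have aeG := ae_integrable2 IG; have aeH := ae_integrable2 IH.
have good : {ae mu, forall y, rV_box P' Q' y -> {ae leb, forall t,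
    A < t < B -> G (t, y) = 0 -> H (t, y) = 0}}.
  apply: filterS3 slices aeG aeH => y yr IGy IHy Py.
  apply: (@ae_weak_derivative_eq0 _ (fun t => H (t, y)) (fun t => G (t, y))) => //.
    by move=> t; exact: gU0.
  move=> r rAB; have rAB' : A <= ratr r <= B by have /andP[/ltW -> /ltW ->] := rAB.
  have := yr (pickle r) Py r (pickleK r) rAB.
  have I1 : leb.-integrable setT (EFin \o (fun t => G (t, y) * trap heaviside A B (ratr r) t)).
    apply: (integrable_boundedM IGy _ _ (fun t => trap_heaviside_le t rAB')).
      exact: measurableT.
    by apply: measurable_trap => // *; exact: measurable_bump_heaviside.
  have I2 : leb.-integrable setT (EFin \o (fun t => H (t, y) * trap ramp A B (ratr r) t)).
    apply: (integrable_boundedM IHy _ _ (fun t => trap_ramp_le t rAB')).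
      exact: measurableT.
    by apply: measurable_trap => // *; exact: measurable_bump_ramp.
  move=> /(congr1 fine); rewrite -[LHS]/(Rintegral _ _ _) RintegralD//.
  by move=> /eqP; rewrite addr_eq0 => /eqP.
(* The exceptional set must be measurable before Tonelli can show it null from its slices; hence the
   zero extensions of g and f, measurable on the whole space. *)
pose S := [set x : 'rV[R]_m.+1 |
  (forall j, P ord0 j < x ord0 j < Q ord0 j) /\ gU x = 0 /\ fU x != 0].
have mgU : measurable_fun setT gU by apply/measurable_EFinP; exact: measurable_int IgU.
have mfU : measurable_fun setT fU by apply/measurable_EFinP; exact: measurable_int IfU.
have mS : measurable S.
  rewrite (_ : S = (\bigcap_(j in [set: 'I_m.+1])
      (@rV_coord _ R m.+1 j @^-1` `]P ord0 j, Q ord0 j[)) `&`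
      (gU @^-1` [set 0] `&` fU @^-1` (~` [set 0]))).
    apply: measurableI.
      apply: fin_bigcap_measurable => // j _; rewrite -[X in measurable X]setTI.
      exact: measurable_rV_coord.
    apply: measurableI; rewrite -[X in measurable X]setTI.
      exact: mgU.
    by apply: mfU => //; exact: measurableC.
  apply/seteqP; split => [x [xPQ [gx fx]]|x [xPQ [gx fx]]].
    split; first by move=> j _ /=; rewrite in_itv/=; exact: xPQ.
    by split => //; exact/eqP.
  split; first by move=> j; have := xPQ j I; rewrite /= in_itv.
  by split => //; exact/eqP.
have S0 : muS S = 0%E.
  rewrite (lebesgue_rV_ins i mS); apply: null_of_ae_null_slices.
    by rewrite -[X in measurable X]setTI; exact: measurable_rV_ins.
  apply: filterS good => y gy.
  have [Py|nPy] := pselect (rV_box P' Q' y); last first.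
    apply: aeW => t [xPQ _]; apply: nPy => k; rewrite in_itv/= !mxE.
    by have := xPQ (lift i k); rewrite rV_ins_lift/= => /andP[-> /ltW ->].
  apply: (filterS _ (gy Py)); first exact: (ae_filter_ringOfSetsType leb).
  move=> t Ht [xPQ [gx fx]]; move/eqP: fx; apply; apply: Ht => //.
  by have := xPQ i; rewrite rV_ins_i.
exists S; split => // x /= /not_implyP[xPQ /not_implyP[gx fx]].
have Ux : U x.
  apply: PQU => j /=; rewrite in_itv/=; have /andP[/ltW -> xQ] := xPQ j.
  by rewrite (le_trans (ltW xQ))// lerDl ltW.
split => //; rewrite /gU /fU !patchE mem_set//; split => //.
exact/eqP.
Qed.

End slicing.

(** * From boxes to open sets; the Poincare inequality *)

Section locality.
Context {R : realType} {m : nat}.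
Local Notation mu := (lebesgue_rV R m.+1).

Lemma ae_partial_eq0 (i : 'I_m.+1) (U : set 'rV[R]_m.+1) (g f : 'rV[R]_m.+1 -> R) :
  open U ->
  mu.-integrable U (EFin \o g) -> mu.-integrable U (EFin \o f) ->
  (forall x, U x -> 0 <= g x) ->
  (forall phi, Cc_smooth U phi ->
    \int[mu]_(x in U) (g x * partial i phi x) = - \int[mu]_(x in U) (f x * phi x)) ->
  {ae mu, forall x, U x -> g x = 0 -> f x = 0}.
Proof.
move=> oU Ig If g0 weak.
have box (ck : 'rV[rat]_m.+1 * nat) :
    ball (map_mx ratr ck.1 : 'rV[R]_m.+1) (2 / ck.2.+1%:R) `<=` U ->
    {ae mu, forall x, rat_box ck x -> g x = 0 -> f x = 0}.
  move=> cU; set d : R := ck.2.+1%:R^-1; have d0 : 0 < d by rewrite invr_gt0.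
  (* Half-width 5d/4 exceeds d, so the interior contains the half-open rational box; with the margin
     d/4 it reaches 3d/2 < 2d and stays in the ball included in [U]. *)
  pose P : 'rV[R]_m.+1 := \row_j (ratr (ck.1 ord0 j) - 5 / 4 * d).
  pose Q : 'rV[R]_m.+1 := \row_j (ratr (ck.1 ord0 j) + 5 / 4 * d).
  have d4 : 0 < d / 4 by rewrite divr_gt0.
  have PQU : [set x : 'rV[R]_m.+1 |
      forall j, x ord0 j \in `[P ord0 j, Q ord0 j + d / 4]] `<=` U.
    move=> x /= xPQ; apply: cU; split; first by rewrite mulr_gt0.
    move=> a j; rewrite ord1 /ball/= !mxE -/d; have := xPQ j.
    rewrite in_itv/= !mxE; set c := ratr _ => /andP[? ?].
    by rewrite ltr_norml; lra.
  apply: filterS (ae_partial_eq0_box oU Ig If g0 weak d4 PQU) => x Hx xck; apply: Hx.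
  move=> j; have := xck j; rewrite in_itv/= !mxE/= -/d; set c := ratr _ => /andP[? ?].
  by lra.
have all_boxes : {ae mu, forall x, forall n (ck : 'rV[rat]_m.+1 * nat),
    unpickle n = Some ck -> ball (map_mx ratr ck.1 : 'rV[R]_m.+1) (2 / ck.2.+1%:R) `<=` U ->
    rat_box ck x -> g x = 0 -> f x = 0}.
  apply: ae_foralln => n.
  case En : (unpickle n : option ('rV[rat]_m.+1 * nat)%type) => [ck|]; last exact: aeW.
  have [cU|ncU] := pselect (ball (map_mx ratr ck.1 : 'rV[R]_m.+1) (2 / ck.2.+1%:R) `<=` U).
    by apply: filterS (box ck cU) => x Hx _ [<-] _; exact: Hx.
  by apply: aeW => x _ [<-].
apply: filterS all_boxes => x Hx Ux.
have : (\bigcup_(ck in [set ck : 'rV[rat]_m.+1 * nat |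
        ball (map_mx ratr ck.1 : 'rV[R]_m.+1) (2 / ck.2.+1%:R) `<=` U]) rat_box ck) x.
  by rewrite -open_bigcup_rat_box.
move=> [ck /= cU xck]; exact: (Hx (pickle ck) ck (pickleK ck) cU xck).
Qed.

Lemma bounded_subset_box (U : set 'rV[R]_m.+1) : bounded_set U ->
  exists M : R, 0 < M /\ U `<=` rV_box (const_mx (- M)) (const_mx M).
Proof.
move=> [M [_ HM]]; exists (`|M| + 2); split; first by rewrite ltr_wpDl.
move=> x Ux i; have : `|x| <= `|M| + 1.
  by apply: HM => //; rewrite (le_lt_trans (ler_norm M))// ltrDl.
move=> /(le_trans (rV_norm_coord x i)); rewrite in_itv/= !mxE ler_norml.
by lra.
Qed.

(** |h| <= 1 + |h|^n, and constants are integrable on a set of finite measure. *)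
Lemma integrable_of_pow (n : nat) d (T : measurableType d) (nu : {measure set T -> \bar R})
    (U : set T) (h : T -> R) : (0 < n)%N -> measurable U -> (nu U < +oo)%E ->
  measurable_fun U h -> (\int[nu]_(x in U) (`|h x| ^+ n)%:E < +oo)%E ->
  nu.-integrable U (EFin \o h).
Proof.
move=> n0 mU finU mh Ih.
have Ip : nu.-integrable U (EFin \o (fun x => `|h x| ^+ n)).
  apply/integrableP; split.
    by apply/measurable_EFinP; apply: measurable_funX; exact: measurableT_comp.
  apply: le_lt_trans Ih; rewrite le_eqVlt; apply/orP; left; apply/eqP.
  by apply: eq_integral => x _; rewrite /= ger0_norm ?exprn_ge0.
have I1 : nu.-integrable U (EFin \o cst (1 : R)).
  by apply: measurable_bounded_integrable => //; exact: bounded_cst.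
have := integrableD mU I1 Ip; apply: le_integrable => //.
  exact/measurable_EFinP.
move=> x Ux; rewrite /= lee_fin.
have [h1|h1] := leP `|h x| 1.
  rewrite [leRHS]ger0_norm; last by rewrite addr_ge0// exprn_ge0.
  by rewrite (le_trans h1)// lerDl exprn_ge0.
rewrite [leRHS]ger0_norm; last by rewrite addr_ge0// exprn_ge0.
rewrite (le_trans _ (_ : `|h x| ^+ n <= _))//; last by rewrite lerDr.
by rewrite -[leLHS]expr1 ler_weXn2l// ltW.
Qed.

Lemma is_derive_line (i : 'I_m.+1) (phi : 'rV[R]_m.+1 -> R) t y :
  derivable phi (rV_ins i (t, y)) (delta_mx ord0 i) ->
  is_derive t (1 : R) (fun t => phi (rV_ins i (t, y))) (partial i phi (rV_ins i (t, y))).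
Proof.
have E h : rV_ins i (h *: (1 : R) + t, y) = h *: delta_mx ord0 i + rV_ins i (t, y).
  apply/rowP => j; rewrite !mxE eqxx; case: (unliftP i j) => [k ->|->].
    by rewrite /= eq_sym (negbTE (neq_lift _ _)) mulr0 add0r.
  by rewrite /= eqxx mulr1 [_ *: 1]mulr1.
move=> dphi.
have EE : (fun h : R => h^-1 *: ((phi \o shift (rV_ins i (t, y))) (h *: delta_mx ord0 i)
      - phi (rV_ins i (t, y)))) =
    (fun h : R => h^-1 *: (((fun t => phi (rV_ins i (t, y))) \o shift t) (h *: (1 : R))
      - phi (rV_ins i (t, y)))).
  by apply/funext => h /=; rewrite E.
by apply: DeriveDef; [rewrite /derivable -EE; exact: dphi|rewrite /derive -EE].
Qed.

Lemma continuous_line (i : 'I_m.+1) (y : 'rV[R]_m) :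
  continuous (fun t : R => rV_ins i (t, y)).
Proof.
move=> t; apply/cvg_ballP => e e0; near=> s; split => // a j; rewrite ord1.
case: (unliftP i j) => [k ->|->]; rewrite ?rV_ins_lift ?rV_ins_i/=.
  exact: ballxx.
by near: s; exact: (@cvgr_dist_lt _ _ _ _ _ id).
Unshelve. all: by end_near. Qed.

Lemma partial_eq0_notin_support (i : 'I_m.+1) (phi : 'rV[R]_m.+1 -> R) x :
  ~ closure [set x | phi x != 0] x -> partial i phi x = 0.
Proof.
move=> nx; rewrite /partial (@near_eq_derive _ _ _ phi (cst 0)); first exact: derive_cst.
have : \forall y \near x, ~ closure [set x | phi x != 0] y.
  apply: open_nbhs_nbhs; split => //.
  by apply: closed_openC; exact: closed_closure.
apply: filterS => y ny; apply/eqP; apply: contra_notT ny => y0.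
exact: subset_closure.
Qed.

(** On each line parallel to the i-th axis, |phi| is at most the integral of |partial i phi| and
    vanishes off an interval of length 2M; integrate along the line, then over all lines. *)
Lemma poincare (i : 'I_m.+1) (U : set 'rV[R]_m.+1) (phi : 'rV[R]_m.+1 -> R) (M : R) :
  0 < M -> open U -> U `<=` rV_box (const_mx (- M)) (const_mx M) -> Cc_smooth U phi ->
  (\int[mu]_(x in U) `|phi x|%:E <=
    (2 * M)%:E * \int[mu]_(x in U) `|partial i phi x|%:E)%E.
Proof.
move=> M0 oU UM [Cphi _ supU]; set leb := @lebesgue_measure R.
have mU := rV_open_measurable oU.
have cphi : continuous phi by move=> x; have [+ _] := Cphi 0%N; apply.
have dphi x : derivable phi x (delta_mx ord0 i).
  by have [_ /(_ i)[+ _]] := Cphi 1%N; apply.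
have cdphi : continuous (partial i phi).
  by move=> x; have [_ /(_ i)[_ [+ _]]] := Cphi 1%N; apply.
have phi0 x : ~ U x -> phi x = 0.
  by move=> nUx; apply/eqP; apply: contra_notT nUx => x0; apply: supU; exact: subset_closure.
have dphi0 x : ~ U x -> partial i phi x = 0.
  by move=> nUx; apply: partial_eq0_notin_support => /supU.
have mphi : measurable_fun setT phi.
  by apply: rV_continuous_measurable; [exact: openT|move=> x _; exact: cphi].
have mdphi : measurable_fun setT (partial i phi).
  by apply: rV_continuous_measurable; [exact: openT|move=> x _; exact: cdphi].
have toT (h : 'rV[R]_m.+1 -> R) : (forall x, ~ U x -> h x = 0) ->
    (\int[mu]_(x in U) `|h x|%:E = \int[mu]_x `|h x|%:E)%E.
  move=> h0; rewrite integral_mkcond; apply: eq_integral => x _; rewrite patchE.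
  by case: ifPn => // /negP; rewrite inE => /h0 ->; rewrite normr0.
have slice (h : 'rV[R]_m.+1 -> R) : measurable_fun setT h ->
    (\int[mu]_x `|h x|%:E = \int[lebesgue_rV R m]_y \int[leb]_t `|h (rV_ins i (t, y))|%:E)%E.
  move=> mh; apply: (@ge0_integral_rV_ins _ _ i (fun x => `|h x|%:E)) => //.
  by apply/measurable_EFinP; exact: measurableT_comp.
rewrite !toT// !slice//.
have line y : (\int[leb]_t `|phi (rV_ins i (t, y))|%:E <=
    (2 * M)%:E * \int[leb]_t `|partial i phi (rV_ins i (t, y))|%:E)%E.
  set F := fun t : R => phi (rV_ins i (t, y)).
  set dF := fun t : R => partial i phi (rV_ins i (t, y)).
  have F_out t : t \notin `]- M, M] -> F t = 0.
    move=> tM; apply: phi0 => /UM /(_ i); rewrite rV_ins_i !mxE/=.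
    exact/negP.
  have dF_F t : is_derive t (1 : R) F (dF t) by exact: is_derive_line.
  have cdF : continuous dF.
    by move=> t; apply: continuous_comp; [exact: continuous_line|exact: cdphi].
  have cF : continuous F := is_derive_continuous dF_F.
  have bound t : (`|F t|%:E <= \int[leb]_t `|dF t|%:E)%E.
    have [tM|/F_out ->] := boolP (t \in `]- M, M]); last first.
      by rewrite normr0; apply: integral_ge0.
    move: tM; rewrite in_itv/= => /andP[Mt tM].
    (* The box is open on the left, so -M already lies outside it. *)
    have FM : F (- M) = 0 by apply: F_out; rewrite in_itv/= ltxx.
    have FTC : (\int[leb]_(s in `[(- M)%R, t]) (dF s)%:E = (F t)%:E - (F (- M))%:E)%E.
      apply: continuous_FTC2 => //.
      - exact: continuous_subspaceT.
      - split; first by move=> s _; have [] := dF_F s.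
          by apply: cvg_at_right_filter; exact: cF.
        by apply: cvg_at_left_filter; exact: cF.
      - by move=> s _; rewrite derive1E; have [_ ->] := dF_F s.
    have -> : F t = fine (\int[leb]_(s in `[(- M)%R, t]) (dF s)%:E)%E.
      by rewrite FTC FM/= subr0.
    have mdF : measurable_fun setT dF by exact: continuous_measurable_fun.
    rewrite -[X in (X <= _)%E]/(`|fine _|%:E)%E -[leLHS]abse_EFin fineK; last first.
      by rewrite FTC.
    apply: le_trans (le_abse_integral _ _ _) _ => //.
      by apply/measurable_EFinP; exact: measurable_funTS.
    apply: ge0_subset_integral => //.
    by apply/measurable_EFinP; exact: measurableT_comp.
  have -> : (\int[leb]_t `|F t|%:E = \int[leb]_(t in `](- M)%R, M]) `|F t|%:E)%E.
    rewrite [RHS]integral_mkcond; apply: eq_integral => t _; rewrite patchE.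
    by case: ifPn => //; rewrite mem_setE => /F_out ->; rewrite normr0.
  apply: (@le_trans _ _ (\int[leb]_(t in `](- M)%R, M]) cst (\int[leb]_t `|dF t|%:E) t)%E).
    apply: ge0_le_integral => //.
    - by apply/measurable_EFinP/measurable_funTS; apply: measurableT_comp => //;
        exact: continuous_measurable_fun.
  have lebM : leb `](- M)%R, M]%classic = (2 * M)%:E.
    rewrite /leb lebesgue_measure_itv/= ifT; last by rewrite lte_fin; lra.
    by rewrite -EFinB (_ : M - - M = 2 * M)//; ring.
  by rewrite integral_cst// muleC [X in (X * _ <= _)%E]lebM.
have mline (h : 'rV[R]_m.+1 -> R) : measurable_fun setT h ->
    measurable_fun setT (fun y => \int[leb]_t `|h (rV_ins i (t, y))|%:E)%E.
  move=> mh; pose h' (z : R * 'rV[R]_m) := `|h (rV_ins i z)|%:E.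
  have mh' : measurable_fun setT h'.
    apply/measurable_EFinP; apply: measurableT_comp => //.
    exact: (measurableT_comp mh (measurable_rV_ins i)).
  have := @measurable_fun_fubini_tonelli_G _ _ _ _ _ leb h' mh'.
  by apply=> z; rewrite lee_fin.
rewrite -ge0_integralZl//; last 3 first.
- exact: mline.
- by move=> y _; exact: integral_ge0.
- by rewrite lee_fin mulr_ge0// ltW.
apply: ge0_le_integral => //.
- by move=> y _; exact: integral_ge0.
- exact: mline.
- by apply: measurable_funeM; exact: mline.
Qed.

End locality.

(** * Functions of W_0 with zero gradient *)

Section zero_gradient.
Context {R : realType} {m : nat}.
Local Notation mu := (lebesgue_rV R m.+1).

Lemma bounded_lebesgue_rV_lty (U : set 'rV[R]_m.+1) : open U -> bounded_set U ->
  (mu U < +oo)%E.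
Proof.
move=> oU /bounded_subset_box[M [_ UM]].
apply: le_lt_trans (lebesgue_rV_box_fin (const_mx (- M)) (const_mx M)).
apply: le_measure => //; rewrite ?inE; first exact: rV_open_measurable.
exact: measurable_rV_box.
Qed.

(** Either |h| <= e, or (|h| / e)^p >= 1. Integrated over a set of finite measure, this does the
    work of Hoelder's inequality between L^1 and L^(p+1). *)
Lemma norm_le_eps_pow (p : nat) (e h : R) : 0 < e ->
  `|h| <= e + e ^- p * `|h| ^+ p.+1.
Proof.
move=> e0; have ep : 0 < e ^+ p by rewrite exprn_gt0.
have [he|eh] := leP `|h| e.
  by rewrite (le_trans he)// lerDl mulr_ge0// ?invr_ge0 ?exprn_ge0// ltW.
apply: ler_wpDl; first exact: ltW.
rewrite ler_pdivlMl// exprSr ler_wpM2r//.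
by rewrite lerXn2r// ?nnegrE// ltW.
Qed.

Lemma L1_small (p : nat) (e : R) (U : set 'rV[R]_m.+1) (h : 'rV[R]_m.+1 -> R) :
  0 < e -> measurable U -> (mu U < +oo)%E -> measurable_fun U h ->
  (\int[mu]_(x in U) (`|h x| ^+ p.+1)%:E <= (e ^+ p.+1)%:E)%E ->
  (\int[mu]_(x in U) `|h x|%:E <= (e * (fine (mu U) + 1))%:E)%E.
Proof.
move=> e0 mU Ufin mh hp.
have mp : measurable_fun U (fun x => (`|h x| ^+ p.+1)%:E).
  by apply/measurable_EFinP; apply: measurable_funX; exact: measurableT_comp.
apply: (@le_trans _ _ (\int[mu]_(x in U) (e%:E + (e ^- p)%:E * (`|h x| ^+ p.+1)%:E))%E).
  apply: ge0_le_integral => //.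
  - by apply/measurable_EFinP; exact: measurableT_comp.
  - by apply: emeasurable_funD => //; exact: measurable_funeM.
  - by move=> x _; rewrite -EFinM -EFinD lee_fin norm_le_eps_pow.
rewrite ge0_integralD//; last 3 first.
- by move=> x _; rewrite lee_fin ltW.
- by move=> x _; rewrite -EFinM lee_fin mulr_ge0// ?exprn_ge0// invr_ge0 exprn_ge0// ltW.
- exact: measurable_funeM.
rewrite integral_cst// ge0_integralZl//; last first.
  by rewrite lee_fin invr_ge0 exprn_ge0// ltW.
rewrite mulrDr EFinD mulr1 EFinM fineK; last by rewrite ge0_fin_numE.
rewrite leeD2l//; apply: (@le_trans _ _ ((e ^- p)%:E * (e ^+ p.+1)%:E)%E).
  by rewrite lee_wpmul2l// lee_fin invr_ge0 exprn_ge0// ltW.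
by rewrite -EFinM lee_fin exprSr mulrA mulVf ?mul1r// expf_neq0// gt_eqF.
Qed.

(** The Poincare inequality is available for the smooth approximants only: their i-th partials tend
    to 0 in L^(p+1), hence in L^1, so the approximants tend to 0 in L^1 while also tending to w. *)
Lemma W1p0_partial_eq0 (p : nat) (U : set 'rV[R]_m.+1) (w : 'rV[R]_m.+1 -> R)
    (Dw : 'rV[R]_m.+1 -> 'rV[R]_m.+1) (i : 'I_m.+1) :
  open U -> bounded_set U -> W1p0 p.+1 U w Dw ->
  {ae mu, forall x, U x -> Dw x ord0 i = 0} ->
  {ae mu, forall x, U x -> w x = 0}.
Proof.
move=> oU bU [[[mw _] mDw _] [phi [Cphi phiw dphi]]] Dw0.
have mU := rV_open_measurable oU.
have Ufin := bounded_lebesgue_rV_lty oU bU.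
have [M [M0 UM]] := bounded_subset_box bU.
have mphi k : measurable_fun U (phi k).
  apply: rV_continuous_measurable => // x _.
  by have [/(_ 0%N)[+ _] _ _] := Cphi k; apply.
have mdphi k : measurable_fun U (partial i (phi k)).
  apply: rV_continuous_measurable => // x _.
  by have [/(_ 1%N)[_ /(_ i)[_ [+ _]]] _ _] := Cphi k; apply.
have {}dphi : (\int[mu]_(x in U) (`|partial i (phi k) x| ^+ p.+1)%:E)%E @[k --> \oo] --> 0%E.
  have := dphi i; apply: cvg_trans; apply: near_eq_cvg; apply: nearW => k /=.
  apply: ae_eq_integral => //.
  - apply/measurable_EFinP; apply: measurable_funX; apply: measurableT_comp => //.
    by apply: measurable_funB => //; have [] := mDw i.
  - by apply/measurable_EFinP; apply: measurable_funX; exact: measurableT_comp.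
  - by apply: filterS Dw0 => x Hx Ux; rewrite Hx// subr0.
(* In the constant, 1 accounts for the distance from w to the approximant and 2M for the Poincare
   inequality. *)
have small (e : R) : 0 < e -> (\int[mu]_(x in U) `|w x|%:E <=
    (e * ((1 + 2 * M) * (fine (mu U) + 1)))%:E)%E.
  move=> e0; have ep : (0 < (e ^+ p.+1)%:E)%E by rewrite lte_fin exprn_gt0.
  have : \forall k \near \oo,
      (\int[mu]_(x in U) (`|phi k x - w x| ^+ p.+1)%:E <= (e ^+ p.+1)%:E)%E /\
      (\int[mu]_(x in U) (`|partial i (phi k) x| ^+ p.+1)%:E <= (e ^+ p.+1)%:E)%E.
    have nb : nbhs 0%E [set y : \bar R | (y <= (e ^+ p.+1)%:E)%E].
      have : nbhs 0%E [set y : \bar R | (y < (e ^+ p.+1)%:E)%E].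
        by apply: open_nbhs_nbhs; split; first exact: open_ereal_lt_ereal.
      by apply: filterS => y /ltW.
    by near=> k; split; near: k; [exact: (phiw _ nb)|exact: (dphi _ nb)].
  move=> [K _ /(_ K (leqnn K)) [pK dK]].
  have mpw : measurable_fun U (fun x => phi K x - w x) by exact: measurable_funB.
  have h1 := L1_small e0 mU Ufin mpw pK.
  have h2 := L1_small e0 mU Ufin (mdphi K) dK.
  apply: (@le_trans _ _ (\int[mu]_(x in U) (`|phi K x - w x|%:E + `|phi K x|%:E))%E).
    apply: ge0_le_integral => //.
    - by apply/measurable_EFinP; exact: measurableT_comp.
    - by apply: emeasurable_funD; apply/measurable_EFinP; exact: measurableT_comp.
    - move=> x _; rewrite -EFinD lee_fin addrC -{1}[w x](subKr (phi K x)).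
      exact: ler_normB.
  rewrite ge0_integralD//; last 2 first.
  - by apply/measurable_EFinP; exact: measurableT_comp.
  - by apply/measurable_EFinP; exact: measurableT_comp.
  rewrite mulrCA mulrDl mul1r EFinD leeD//.
  apply: le_trans (poincare i M0 oU UM (Cphi K)) _.
  by rewrite [leRHS]EFinM lee_wpmul2l// lee_fin mulr_ge0// ltW.
have w0 : (\int[mu]_(x in U) `|(w x)%:E| = 0)%E.
  apply/eqP; rewrite eq_le integral_ge0// andbT.
  apply/lee_addgt0Pr => e e0; rewrite add0e.
  set C := (1 + 2 * M) * (fine (mu U) + 1).
  have C0 : 0 < C by rewrite mulr_gt0// ltr_wpDl ?fine_ge0//; lra.
  by have := small (e / C) (divr_gt0 e0 C0); rewrite -/C divfK// gt_eqF.
have mw' : measurable_fun U (EFin \o w) by exact/measurable_EFinP.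
have /(ae_eq_integral_abs mu mU mw') := w0.
by apply: filterS => x Hx Ux; have := Hx Ux => -[].
Unshelve. all: by end_near. Qed.

End zero_gradient.

(** * Directional derivatives of C^1 functions *)

Section directional_derivative.
Context {R : realType} {n : nat}.
Implicit Types (F : 'rV[R]_n -> R) (x y v : 'rV[R]_n).

Lemma MVT0 (f df : R -> R) (b : R) :
  (forall s, `|s| <= `|b| -> is_derive s (1 : R) f (df s)) ->
  exists2 s, `|s| <= `|b| & f b - f 0 = df s * b.
Proof.
move=> dfE; have cont (c d : R) : `|c| <= `|b| -> `|d| <= `|b| ->
    {within `[c, d], continuous f}.
  rewrite !ler_norml => /andP[bc _] /andP[_ db].
  apply: derivable_within_continuous => s; rewrite in_itv/= => /andP[cs sd].
  have sb : `|s| <= `|b| by rewrite ler_norml; lra.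
  by have [] := dfE s sb.
have [b0|b0] := leP 0 b.
  have [||s] := @MVT_segment _ f df 0 b b0.
  - move=> s; rewrite in_itv/= => /andP[s0 sb]; apply: dfE.
    by rewrite ger0_norm ?ger0_norm// ltW.
  - by apply: cont; rewrite ?normr0.
  rewrite in_itv/= => /andP[s0 sb] ->; exists s; last by rewrite subr0.
  by rewrite !ger0_norm.
have [||s] := @MVT_segment _ f df b 0 (ltW b0).
- move=> s; rewrite in_itv/= => /andP[bs s0]; apply: dfE.
  by rewrite !ltr0_norm// lerN2 ltW.
- by apply: cont; rewrite ?normr0.
rewrite in_itv/= => /andP[bs s0] E; exists s.
  by rewrite ler0_norm// ltr0_norm// lerN2.
by rewrite -[LHS]opprB E sub0r mulrN opprK.
Qed.

Lemma is_derive_coordinate F (k : 'I_n) y s :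
  derivable F (y + s *: delta_mx ord0 k) (delta_mx ord0 k) ->
  is_derive s (1 : R) (fun s => F (y + s *: delta_mx ord0 k))
    (partial k F (y + s *: delta_mx ord0 k)).
Proof.
move=> dF; set e := delta_mx ord0 k : 'rV[R]_n.
have E : (fun h : R => h^-1 *: ((F \o shift (y + s *: e)) (h *: e) - F (y + s *: e))) =
    (fun h : R => h^-1 *: (((fun s => F (y + s *: e)) \o shift s) (h *: (1 : R))
      - F (y + s *: e))).
  apply/funext => h /=; congr (_ *: (F _ - _)).
  by rewrite [h *: 1]mulr1 scalerDl addrCA.
by apply: DeriveDef; [rewrite /derivable -E; exact: dF|rewrite /derive -E].
Qed.

(** The base point a(h) moves with h, so the derivative at x alone is not enough: the mean value
    theorem puts the partial derivative at a point tending to x, where continuity applies. *)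
Lemma cvg_coordinate_increment F x (k : 'I_n) (c : R) (a : R -> 'rV[R]_n) :
  a h @[h --> (0 : R)] --> x ->
  (\forall y \near x, derivable F y (delta_mx ord0 k)) ->
  {for x, continuous (partial k F)} ->
  h^-1 * (F (a h + (h * c) *: delta_mx ord0 k) - F (a h)) @[h --> 0^'] -->
  c * partial k F x.
Proof.
move=> ax dF cF; set e := delta_mx ord0 k.
apply/cvgrPdist_le => eps eps0.
(* The added 1 keeps the divisor positive when c = 0. *)
have c0 : 0 < `|c| + 1 by rewrite ltr_wpDl.
have eps' : 0 < eps / (`|c| + 1) by rewrite divr_gt0.
have : \forall y \near x, derivable F y e /\
    `|partial k F x - partial k F y| <= eps / (`|c| + 1).
  by near=> y; split; near: y => //; move/cvgrPdist_le : cF; exact.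
move=> /nbhs_ballP[r /= r0 xr].
have r2 : 0 < r / 2 by rewrite divr_gt0.
have near_a : \forall h \near 0^', ball x (r / 2) (a h).
  by apply: cvg_within; apply: ax; exact: nbhsx_ballx.
have near_h : \forall h \near 0^', `|h * c| < r / 2.
  near=> h; rewrite normrM; have : `|h| < (r / 2) / (`|c| + 1).
    by near: h; apply: dnbhs0_lt; rewrite divr_gt0.
  rewrite ltr_pdivlMr//; apply: le_lt_trans.
  by rewrite ler_wpM2l// lerDl.
near=> h; have h0 : h != 0 by near: h; exact: nbhs_dnbhs_neq.
have ah : ball x (r / 2) (a h) by near: h.
have hc : `|h * c| < r / 2 by near: h.
have in_ball s : `|s| <= `|h * c| -> ball x r (a h + s *: e).
  move=> sh; rewrite [r]splitr; apply: ball_triangle ah _.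
  split => // i j; rewrite ord1 /ball/= !mxE opprD addNKr normrN normrM.
  apply: le_lt_trans hc; apply: le_trans sh; rewrite ler_piMr//.
  by case: (_ && _); rewrite ?normr1 ?normr0.
have [s sh E] := @MVT0 (fun s => F (a h + s *: e)) (fun s => partial k F (a h + s *: e)) (h * c)
  (fun s sh => is_derive_coordinate (xr _ (in_ball s sh)).1).
move: E; rewrite scale0r addr0 => ->.
rewrite mulrCA [h^-1 * _]mulrA mulVf// mul1r mulrC -mulrBl normrM.
have [_ Hs] := xr _ (in_ball s sh).
apply: le_trans (ler_wpM2r _ Hs) _ => //.
by rewrite mulrAC ler_pdivrMr// ler_wpM2l ?lerDl// ltW.
Unshelve. all: by end_near. Qed.

(** [Ck_on] speaks of coordinate directions only. The increment h v is traversed one coordinate at a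
    time, by induction on the list of coordinates. *)
Lemma is_derive_C1 F x v :
  (forall k, \forall y \near x, derivable F y (delta_mx ord0 k)) ->
  (forall k, {for x, continuous (partial k F)}) ->
  is_derive x v F (\sum_k v ord0 k * partial k F x).
Proof.
move=> dF cF.
have step (s : seq 'I_n) :
    h^-1 * (F (x + h *: \sum_(k <- s) v ord0 k *: delta_mx ord0 k) - F x) @[h --> 0^'] -->
    \sum_(k <- s) v ord0 k * partial k F x.
  elim: s => [|k s IH].
    rewrite big_nil; apply: cvg_near_cst; apply: nearW => h.
    by rewrite big_nil scaler0 addr0 subrr mulr0.
  rewrite [X in _ --> X]big_cons.
  pose w : 'rV[R]_n := \sum_(k <- s) v ord0 k *: delta_mx ord0 k.
  have ax : (x + h *: w) @[h --> (0 : R)] --> x.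
    rewrite -[X in _ --> X]addr0 -(scale0r w); apply: cvgD; first exact: cvg_cst.
    by apply: cvgZr_tmp; exact: cvg_id.
  have c1 := @cvg_coordinate_increment F x k (v ord0 k) _ ax (dF k) (cF k).
  have c2 := cvgD c1 IH.
  have -> : (fun h : R => h^-1 * (F (x + h *: \sum_(j <- k :: s)
        v ord0 j *: delta_mx ord0 j) - F x)) =
      (fun h : R => h^-1 * (F (x + h *: w + (h * v ord0 k) *: delta_mx ord0 k) - F (x + h *: w))
        + h^-1 * (F (x + h *: w) - F x)).
    apply/funext => h; rewrite big_cons -/w -mulrDr addrA subrK.
    by rewrite scalerDr scalerA addrA addrAC.
  exact: c2.
have := step (index_enum 'I_n).
have -> : \sum_(k <- index_enum 'I_n) v ord0 k *: delta_mx ord0 k = v.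
  by rewrite [RHS]row_sum_delta.
move=> cvF.
have E : (fun h : R => h^-1 *: ((F \o shift x) (h *: v) - F x)) =
    (fun h : R => h^-1 * (F (x + h *: v) - F x)).
  by apply/funext => h; rewrite /= [h *: v + x]addrC.
apply: DeriveDef; first by rewrite /derivable E; apply/cvg_ex; eexists; exact: cvF.
by rewrite /derive E; apply/cvg_lim => //; exact: cvF.
Qed.

End directional_derivative.

(** * Algebra of the scalar product *)

Lemma dotE {R : realType} {n : nat} (x y : 'rV[R]_n) :
  dot x y = \sum_i x ord0 i * y ord0 i.
Proof. by rewrite /dot mxE; apply: eq_bigr => i _; rewrite mxE. Qed.

Lemma dotDr {R : realType} {n : nat} (x y z : 'rV[R]_n) : dot x (y + z) = dot x y + dot x z.
Proof. by rewrite /dot linearD/= mulmxDr mxE. Qed.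

Lemma dotNr {R : realType} {n : nat} (x y : 'rV[R]_n) : dot x (- y) = - dot x y.
Proof. by rewrite /dot linearN/= mulmxN mxE. Qed.

Lemma dotBl {R : realType} {n : nat} (x y z : 'rV[R]_n) : dot (x - y) z = dot x z - dot y z.
Proof. by rewrite /dot mulmxBl !mxE. Qed.

Lemma dotZl {R : realType} {n : nat} (a : R) (x y : 'rV[R]_n) : dot (a *: x) y = a * dot x y.
Proof. by rewrite /dot -scalemxAl mxE. Qed.

Lemma dotZr {R : realType} {n : nat} (a : R) (x y : 'rV[R]_n) : dot x (a *: y) = a * dot x y.
Proof. by rewrite /dot linearZ/= -scalemxAr mxE. Qed.

Lemma dot0l {R : realType} {n : nat} (x : 'rV[R]_n) : dot 0 x = 0.
Proof. by rewrite /dot mul0mx mxE. Qed.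

Lemma is_derive_eq0 {R : realType} {n : nat} (f : 'rV[R]_n -> R) x v (df : R) :
  is_derive x v f df -> (\forall h \near (0 : R), f (h *: v + x) = f x) -> df = 0.
Proof.
move=> [_ <-] fx; rewrite /derive; apply/cvg_lim => //.
apply: cvg_near_cst; near=> h.
have fh : f (h *: v + x) = f x by near: h; apply: cvg_within.
by rewrite /= fh subrr scaler0.
Unshelve. all: by end_near. Qed.

(** * The field F^{N-1} F_xi *)

Section anisotropic_norm.
Context {R : realType} {N : nat} (F : 'rV[R]_N -> R).
Implicit Types xi eta v : 'rV[R]_N.

Hypothesis F_ge0 : forall xi, 0 <= F xi.
Hypothesis F_convex : convex_function [set: 'rV[R]_N] F.
Hypothesis F_C2 : Ck_on 2 [set xi : 'rV[R]_N | xi != 0] F.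
Hypothesis F_homogeneous : forall (t : R) xi, F (t *: xi) = `|t| * F xi.
Hypothesis F_gt0 : forall xi, xi != 0 -> 0 < F xi.
Hypothesis F_hessian : forall xi, xi != 0 ->
  positive_definite (hessian (fun eta => F eta ^+ 2) xi).

Lemma F_eq0 : F 0 = 0.
Proof. by rewrite -(scale0r 0) F_homogeneous normr0 mul0r. Qed.

Lemma F_opp xi : F (- xi) = F xi.
Proof. by rewrite -scaleN1r F_homogeneous normrN1 mul1r. Qed.

(** Convexity at the midpoint, rescaled by homogeneity with factor 2. *)
Lemma F_subadd xi eta : F (xi + eta) <= F xi + F eta.
Proof.
have H : F (2^-1 *: xi + (1 - 2^-1) *: eta) <= 2^-1 * F xi + (1 - 2^-1) * F eta.
  have p0 : 0 <= 2^-1 :> R by lra.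
  have p1 : 2^-1 <= 1 :> R by lra.
  exact: (F_convex (Itv01 p0 p1) (mem_set I) (mem_set I)).
have h2 : 1 - 2^-1 = 2^-1 :> R by lra.
have -> : xi + eta = 2 *: (2^-1 *: xi + (1 - 2^-1) *: eta).
  by rewrite h2 -scalerDr scalerA mulfV ?scale1r// pnatr_eq0.
by rewrite F_homogeneous ger0_norm//; move: H; rewrite h2; lra.
Qed.

Lemma near_neq0 xi : xi != 0 -> \forall eta \near xi, eta != 0.
Proof.
move=> xi0; apply/nbhs_ballP; exists `|xi| => /=; first by rewrite normr_gt0.
move=> eta; rewrite -ball_normE /=; apply: contraTneq => ->.
by rewrite subr0 ltxx.
Qed.

Lemma F_partial k xi : xi != 0 -> derivable F xi (delta_mx ord0 k).
Proof. by have [_ /(_ k)[+ _]] := F_C2; apply. Qed.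

Lemma F_partial_continuous k xi : xi != 0 -> {for xi, continuous (partial k F)}.
Proof. by have [_ /(_ k)[_ [+ _]]] := F_C2; apply. Qed.

Lemma F_partial2 j k xi : xi != 0 -> derivable (partial k F) xi (delta_mx ord0 j).
Proof. by have [_ /(_ k)[_ [_ /(_ j)[+ _]]]] := F_C2; apply. Qed.

Lemma F_partial2_continuous j k xi : xi != 0 ->
  {for xi, continuous (partial j (partial k F))}.
Proof. by have [_ /(_ k)[_ [_ /(_ j)[_ [+ _]]]]] := F_C2; apply. Qed.

Lemma F_is_derive xi v : xi != 0 -> is_derive xi v F (dot (gradient F xi) v).
Proof.
move=> xi0; rewrite dotE.
under eq_bigr do rewrite mxE mulrC.
apply: is_derive_C1 => k; last exact: F_partial_continuous.
by apply: filterS (near_neq0 xi0) => eta; exact: F_partial.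
Qed.

Lemma F_partial_is_derive k xi v : xi != 0 ->
  is_derive xi v (partial k F) (\sum_j v ord0 j * partial j (partial k F) xi).
Proof.
move=> xi0; apply: is_derive_C1 => j; last exact: F_partial2_continuous.
by apply: filterS (near_neq0 xi0) => eta; exact: F_partial2.
Qed.

(** Euler's relation: for |h| < 1 the difference quotient ((1 + h) F(xi) - F(xi)) / h is already
    F(xi). *)
Lemma gradient_euler xi : xi != 0 -> dot (gradient F xi) xi = F xi.
Proof.
move=> xi0; have [dF <-] := F_is_derive xi xi0.
apply/cvg_lim => //; apply: cvg_near_cst; near=> h.
have h0 : h != 0 by near: h; exact: nbhs_dnbhs_neq.
rewrite /= -{2}[xi]scale1r -scalerDl F_homogeneous ger0_norm.
  by rewrite mulrDl mul1r addrK /GRing.scale/= mulrA mulVf// mul1r.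
have : `|h| < 1 by near: h; exact: dnbhs0_lt.
by rewrite ltr_norml => /andP[? _]; lra.
Unshelve. all: by end_near. Qed.

(** By subadditivity each right difference quotient of F at xi in direction eta is at most
    F(eta). *)
Lemma gradient_le xi eta : xi != 0 -> dot (gradient F xi) eta <= F eta.
Proof.
move=> xi0; have [dF <-] := F_is_derive eta xi0.
apply: (cvgr_to_le (cvg_dnbhs_at_right dF)); near=> h.
have h0 : 0 < h by [].
rewrite /= /GRing.scale/= ler_pdivrMl// lerBlDr (le_trans (F_subadd _ _))//.
by rewrite F_homogeneous gtr0_norm.
Unshelve. all: by end_near. Qed.

Lemma partial_le k xi : xi != 0 -> `|partial k F xi| <= F (delta_mx ord0 k).
Proof.
move=> xi0.
have dotk : dot (gradient F xi) (delta_mx ord0 k) = partial k F xi.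
  rewrite dotE (bigD1 k)//= !mxE !eqxx mulr1 big1 ?addr0// => j jk.
  by rewrite !mxE (negbTE jk) andbF mulr0.
rewrite ler_norml -{2}dotk gradient_le// andbT lerNl -dotk.
have := gradient_le (- delta_mx ord0 k) xi0; rewrite F_opp.
by rewrite dotNr.
Qed.

Lemma F_le_sum xi : F xi <= \sum_k `|xi ord0 k| * F (delta_mx ord0 k).
Proof.
rewrite {1}[xi]row_sum_delta.
elim: (index_enum _) => [|k s IH]; first by rewrite !big_nil F_eq0.
by rewrite !big_cons (le_trans (F_subadd _ _))// F_homogeneous lerD2l.
Qed.

Lemma hessian_sqrE j k xi : xi != 0 -> hessian (fun eta => F eta ^+ 2) xi j k =
  2 * (partial j F xi * partial k F xi + F xi * partial j (partial k F) xi).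
Proof.
move=> xi0; rewrite mxE.
have partial_sqr eta : eta != 0 ->
    partial k (fun eta => F eta ^+ 2) eta = 2 * (F eta * partial k F eta).
  move=> eta0; have dF := derivableP (@F_partial k _ eta0).
  transitivity ('D_(delta_mx ord0 k) (F ^+ 2) eta); first by rewrite exprfctE.
  by rewrite deriveX//= ?expr1 /GRing.scale/= ?mulrA//; exact: F_partial.
rewrite {1}/partial (@near_eq_derive _ _ _ _ (fun eta => 2 * (F eta * partial k F eta))).
  have dF := derivableP (@F_partial j _ xi0).
  have dpF := derivableP (@F_partial2 j k _ xi0).
  have [_] := is_deriveZ 2 (is_deriveM dF dpF) => ->.
  by rewrite /GRing.scale/= -/(partial j F xi) -/(partial j (partial k F) xi); ring.
by apply: filterS (near_neq0 xi0) => eta; exact: partial_sqr.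
Qed.

(* On the segment [xi, eta], F is at most F xi by convexity and at least F xi by
   [gradient_le], so it is constant there and the second derivative of F^2 along
   eta - xi vanishes at the midpoint. *)
Lemma gradient_strict xi eta : xi != 0 -> eta != 0 -> F xi = F eta ->
  dot (gradient F xi) eta = F eta -> xi = eta.
Proof.
move=> xi0 eta0 Fxe gradE; apply/eqP/negPn/negP => xe.
set v := eta - xi; have v0 : v != 0 by rewrite subr_eq0 eq_sym.
set s := F xi; have s0 : 0 < s by exact: F_gt0.
(* Centred at the midpoint, the segment is |t| <= 1/2, so t = 0 is interior and two-sided
   derivatives can be taken there. *)
pose z := xi + 2^-1 *: v.
have lineE (t : R) : t *: v + z = (2^-1 - t) *: xi + (2^-1 + t) *: eta.
  by apply/rowP => i; rewrite !mxE; field.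
have F_line (t : R) : `|t| <= 2^-1 -> F (t *: v + z) = s.
  rewrite ler_norml => /andP[t1 t2]; rewrite lineE.
  apply/eqP; rewrite eq_le; apply/andP; split.
    rewrite (le_trans (F_subadd _ _))// !F_homogeneous -Fxe -/s.
    rewrite !ger0_norm; [|lra..].
    by rewrite -mulrDl (_ : _ + _ = 1) ?mul1r//; lra.
  apply: le_trans (gradient_le _ xi0).
  rewrite dotDr !dotZr gradE gradient_euler// -Fxe -/s -mulrDl.
  by rewrite (_ : _ + _ = 1) ?mul1r//; lra.
have line0 (t : R) : `|t| <= 2^-1 -> t *: v + z != 0.
  by move=> /F_line Ft; apply/eqP => t0; move: Ft s0; rewrite t0 F_eq0 => <-; rewrite ltxx.
have n0 : \forall t \near (0 : R), `|t| < 2^-1.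
  by apply: nbhs0_lt; rewrite invr_gt0.
have Dv0 (t : R) : `|t| < 2^-1 -> \sum_k v ord0 k * partial k F (t *: v + z) = 0.
  move=> t2; have tv0 := line0 _ (ltW t2).
  have := is_derive_eq0 (F_is_derive v tv0).
  rewrite dotE; under eq_bigr do rewrite mxE mulrC.
  apply; near=> h; rewrite addrA -scalerDl !F_line ?(ltW t2)//.
  rewrite (le_trans (ler_normD _ _))// -lerBrDr; apply: ltW; near: h.
  apply/nbhs_ballP; exists (2^-1 - `|t|); first by rewrite /= subr_gt0.
  by move=> y; rewrite /ball/= sub0r normrN.
have D0 : \sum_k v ord0 k * partial k F z = 0.
  by have := Dv0 0; rewrite scale0r add0r => ->//; rewrite normr0 invr_gt0.
pose f eta := \sum_k v ord0 k * partial k F eta.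
have z0 : z != 0 by have := line0 0; rewrite scale0r add0r normr0; apply; rewrite invr_ge0.
have df : is_derive z v f (\sum_k v ord0 k * \sum_j v ord0 j * partial j (partial k F) z).
  have -> : f = \sum_k (v ord0 k \*: partial k F).
    by apply/funext => y; rewrite /f fct_sumE.
  by apply: is_derive_sum => k; apply: is_deriveZ; exact: F_partial_is_derive.
have H0 : \sum_k v ord0 k * \sum_j v ord0 j * partial j (partial k F) z = 0.
  have := is_derive_eq0 df; apply; near=> h.
  by rewrite /f D0 Dv0//; near: h.
have := F_hessian z0 v0.
suff -> : (v *m hessian (fun eta => F eta ^+ 2) z *m v^T) ord0 ord0 = 0 by rewrite ltxx.
rewrite mxE.
under eq_bigr => k _.
  rewrite [X in X * _]mxE [X in _ * X]mxE.
  under eq_bigr do rewrite hessian_sqrE//.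
  over.
(* The quadratic form of Hess(F^2) along v is 2 (grad F . v)^2 + 2 F times that of Hess(F); both
   parts vanish at the midpoint. *)
transitivity (2 * ((\sum_k v ord0 k * partial k F z) * \sum_k v ord0 k * partial k F z)
    + 2 * F z * \sum_k v ord0 k * \sum_j v ord0 j * partial j (partial k F) z).
  rewrite mulr_sumr !mulr_sumr -big_split/=; apply: eq_bigr => k _.
  rewrite mulr_suml mulr_suml mulr_sumr mulr_sumr mulr_sumr -big_split/=.
  by apply: eq_bigr => j _; ring.
by rewrite D0 H0 !mulr0 addr0.
Unshelve. all: by end_near. Qed.

(** With s = F(xi), r = F(eta), p = N - 1, the product is s^p (s - a) + r^p (r - b), where a <= r
    and b <= s by [gradient_le]. It is thus at least (s^p - r^p)(s - r), positive if s <> r. If s =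
    r, both terms are nonnegative, and a zero sum gives a = s, the equality case of
    [gradient_strict]. At the origin, where the flux is set to 0, the claim reduces to Euler's
    relation. *)
Lemma QN_flux_monotone xi eta : (1 < N)%N ->
  0 <= dot (QN_flux F xi - QN_flux F eta) (xi - eta) /\
  (dot (QN_flux F xi - QN_flux F eta) (xi - eta) = 0 -> xi = eta).
Proof.
move=> N1; have p0 : (0 < N.-1)%N by case: N N1 => [|[]].
have dot_flux x : x != 0 -> dot (QN_flux F x) x = F x ^+ N.-1 * F x.
  by move=> x0; rewrite /QN_flux (negbTE x0) dotZl gradient_euler.
have pos x : x != 0 -> 0 < F x ^+ N.-1 * F x.
  by move=> x0; rewrite mulr_gt0// ?exprn_gt0//; exact: F_gt0.
have [->|xi0] := eqVneq xi 0.
  rewrite {1 3}/QN_flux eqxx !sub0r dotNr -[- QN_flux F eta]sub0r dotBl dot0l sub0r opprK.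
  have [->|eta0] := eqVneq eta 0; first by rewrite /QN_flux eqxx dot0l.
  rewrite dot_flux//; split; first exact/ltW/pos.
  by move=> H; have := pos _ eta0; rewrite H ltxx.
have [->|eta0] := eqVneq eta 0.
  rewrite [QN_flux F 0]/QN_flux eqxx !subr0 dot_flux//; split; first exact/ltW/pos.
  by move=> H; have := pos _ xi0; rewrite H ltxx.
set s := F xi; set r := F eta; set p := N.-1.
have s0 : 0 < s := F_gt0 xi0; have r0 : 0 < r := F_gt0 eta0.
have gr := gradient_le eta xi0; have gs := gradient_le xi eta0.
rewrite -/r in gr; rewrite -/s in gs.
have -> : dot (QN_flux F xi - QN_flux F eta) (xi - eta) =
    s ^+ p * (s - dot (gradient F xi) eta) + r ^+ p * (r - dot (gradient F eta) xi).
  rewrite /QN_flux (negbTE xi0) (negbTE eta0) dotBl !dotDr !dotNr !dotZl.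
  by rewrite !gradient_euler// -/s -/r -/p; ring.
set a := dot _ eta; set b := dot _ xi.
have sp : 0 < s ^+ p by rewrite exprn_gt0.
have rp : 0 < r ^+ p by rewrite exprn_gt0.
have lower : (s ^+ p - r ^+ p) * (s - r) <= s ^+ p * (s - a) + r ^+ p * (r - b).
  have -> : (s ^+ p - r ^+ p) * (s - r) = s ^+ p * (s - r) + r ^+ p * (r - s) by ring.
  by rewrite lerD// ler_pM2l// lerB.
have gap : s != r -> 0 < (s ^+ p - r ^+ p) * (s - r).
  rewrite neq_lt => /orP[sr|rs].
    by rewrite -mulrNN !opprB mulr_gt0// subr_gt0// ltrXn2r// ?ltW// -lt0n.
  by rewrite mulr_gt0// subr_gt0// ltrXn2r// ?ltW// -lt0n.
have [sr|sr] := eqVneq s r; last first.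
  have := lt_le_trans (gap sr) lower => tot; split; first exact: ltW.
  by move=> H; move: tot; rewrite H ltxx.
have ar : 0 <= s ^+ p * (s - a) by apply: mulr_ge0; [exact: ltW|rewrite subr_ge0 sr].
have br : 0 <= r ^+ p * (r - b) by apply: mulr_ge0; [exact: ltW|rewrite subr_ge0 -sr].
split; first exact: addr_ge0.
move=> /eqP; rewrite paddr_eq0// => /andP[+ _].
rewrite mulf_eq0 gt_eqF//= subr_eq0 => /eqP sa.
by apply: gradient_strict => //; rewrite -/a -sa.
Qed.

(** Growth of order N - 1 in xi, so that the flux of an L^N field paired with an L^N field is
    integrable. *)
Lemma QN_flux_bound xi i : `|QN_flux F xi ord0 i| <=
  (\sum_k `|xi ord0 k| * F (delta_mx ord0 k)) ^+ N.-1 * F (delta_mx ord0 i).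
Proof.
have S0 : 0 <= \sum_k `|xi ord0 k| * F (delta_mx ord0 k).
  by apply: sumr_ge0 => k _; rewrite mulr_ge0.
rewrite /QN_flux; case: eqVneq => [_|xi0].
  by rewrite mxE normr0 mulr_ge0// exprn_ge0.
rewrite !mxE normrM ler_pM//; last exact: partial_le.
by rewrite normrX ger0_norm// lerXn2r// ?nnegrE// F_le_sum.
Qed.

(** Away from the origin the flux is continuous on an open set; elsewhere it is 0, so it is the zero
    extension of a measurable function. *)
Lemma measurable_QN_flux i : measurable_fun setT (fun xi => QN_flux F xi ord0 i).
Proof.
pose U := [set xi : 'rV[R]_N | xi != 0].
have oU : open U by rewrite openE => xi xi0; exact: near_neq0.
have -> : (fun xi => QN_flux F xi ord0 i) =
    (fun xi => F xi ^+ N.-1 * partial i F xi) \_ U.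
  apply/funext => xi; rewrite patchE /QN_flux; case: ifPn => [/eqP ->|xi0].
    by rewrite memNset; [rewrite mxE|rewrite /U/= eqxx].
  by rewrite mem_set// !mxE.
apply/(measurable_restrictT _ (rV_open_measurable oU)).
apply: measurable_funM.
  apply: measurable_funX; apply: rV_continuous_measurable => // xi xi0.
  by have [+ _] := F_C2; apply.
by apply: rV_continuous_measurable => // xi xi0; exact: F_partial_continuous.
Qed.

End anisotropic_norm.

(** * Comparison principle *)

Section test_functions.
Context {R : realType} {m : nat}.
Local Notation mu := (lebesgue_rV R m.+1).
Implicit Types (U : set 'rV[R]_m.+1) (phi g h : 'rV[R]_m.+1 -> R).

Lemma bounded_of_compact_support phi (K : set 'rV[R]_m.+1) : continuous phi ->
  compact K -> (forall x, ~ K x -> phi x = 0) -> exists M, forall x, `|phi x| <= M.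
Proof.
move=> cphi cK phi0.
have : compact (phi @` K) by apply: continuous_compact => //; exact: continuous_subspaceT.
move=> /compact_bounded[M [_ HM]]; exists (`|M| + 1) => x.
have [Kx|/phi0 ->] := pselect (K x); last by rewrite normr0 addr_ge0.
by apply: HM; [rewrite (le_lt_trans (ler_norm _))// ltrDl|exists x].
Qed.

Lemma integrable_continuousM U h phi (M : R) : open U ->
  mu.-integrable U (EFin \o h) -> continuous phi -> (forall x, `|phi x| <= M) ->
  mu.-integrable U (EFin \o (fun x => h x * phi x)).
Proof.
move=> oU Ih cphi phiM; have mU := rV_open_measurable oU.
apply: (integrable_boundedM Ih mU _ phiM).
by apply: rV_continuous_measurable => // x _; exact: cphi.
Qed.

(** The real-valued integral is additive only on integrable functions; the products are integrable
    because [phi] and its partial derivatives are bounded, being continuous with compact support. *)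
Lemma weak_partialB U (i : 'I_m.+1) g h (Dg Dh : 'rV[R]_m.+1 -> R) : open U ->
  mu.-integrable U (EFin \o g) -> mu.-integrable U (EFin \o h) ->
  mu.-integrable U (EFin \o Dg) -> mu.-integrable U (EFin \o Dh) ->
  (forall phi, Cc_smooth U phi ->
    \int[mu]_(x in U) (g x * partial i phi x) = - \int[mu]_(x in U) (Dg x * phi x)) ->
  (forall phi, Cc_smooth U phi ->
    \int[mu]_(x in U) (h x * partial i phi x) = - \int[mu]_(x in U) (Dh x * phi x)) ->
  forall phi, Cc_smooth U phi ->
    \int[mu]_(x in U) ((g x - h x) * partial i phi x) =
    - \int[mu]_(x in U) ((Dg x - Dh x) * phi x).
Proof.
move=> oU Ig Ih IDg IDh wg wh phi Cphi.
have mU := rV_open_measurable oU; have [sphi Kphi _] := Cphi.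
have cphi : continuous phi by move=> x; have [+ _] := sphi 0%N; apply.
have cdphi : continuous (partial i phi).
  by move=> x; have [_ /(_ i)[_ [+ _]]] := sphi 1%N; apply.
have [M0 HM0] : exists M, forall x, `|phi x| <= M.
  apply: (bounded_of_compact_support cphi Kphi) => x nx; apply/eqP.
  by apply: contra_notT nx => x0; exact: subset_closure.
have [M1 HM1] : exists M, forall x, `|partial i phi x| <= M.
  apply: (bounded_of_compact_support cdphi Kphi) => x.
  exact: partial_eq0_notin_support.
under eq_Rintegral do rewrite mulrBl.
under [in RHS]eq_Rintegral do rewrite mulrBl.
rewrite !RintegralB//; try exact: integrable_continuousM HM0;
  try exact: integrable_continuousM HM1.
by rewrite wg// wh//; ring.
Qed.

Lemma measurable_fun_comp_rV d (T : measurableType d) (f : 'rV[R]_m.+1 -> R)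
    (D : T -> 'rV[R]_m.+1) (V : set T) : measurable V ->
  measurable_fun setT f -> (forall i, measurable_fun V (fun x => D x ord0 i)) ->
  measurable_fun V (fun x => f (D x)).
Proof.
(* Setting D to 0 off V makes it measurable on the whole space, where [measurable_fun_rVP]
   applies. *)
move=> mV mf mD; pose D' x := if x \in V then D x else 0.
have mD' : measurable_fun setT D'.
  apply/measurable_fun_rVP => i.
  have -> : rV_coord i \o D' = (fun x => D x ord0 i) \_ V.
    by apply/funext => x; rewrite patchE /D' /rV_coord/=; case: ifP; rewrite ?mxE.
  exact/(measurable_restrictT _ mV).
apply: (@eq_measurable_fun _ _ _ _ V (f \o D')); last exact/measurable_funTS/measurableT_comp.
by move=> x xV; rewrite /= /D' xV.
Qed.

End test_functions.

(** * Integrability of powers and of products *)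

Section power_integrable.
Context {d} {T : measurableType d} {R : realType} (nu : {measure set T -> \bar R}).
Variables (U : set T) (p : nat).
Hypothesis mU : measurable U.
Implicit Types (h k : T -> R).

Definition pow_integrable h :=
  measurable_fun U h /\ nu.-integrable U (EFin \o (fun x => `|h x| ^+ p.+1)).

Let measurable_pow h : measurable_fun U h -> measurable_fun U (fun x => `|h x| ^+ p.+1).
Proof. by move=> mh; apply: measurable_funX; exact: measurableT_comp. Qed.

Lemma pow_integrableP h : measurable_fun U h ->
  (\int[nu]_(x in U) (`|h x| ^+ p.+1)%:E < +oo)%E -> pow_integrable h.
Proof.
move=> mh hfin; split => //; apply/integrableP; split.
  by apply/measurable_EFinP; exact: measurable_pow.
apply: le_lt_trans hfin; rewrite le_eqVlt; apply/orP; left; apply/eqP.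
by apply: eq_integral => x _; rewrite /= ger0_norm ?exprn_ge0.
Qed.

Lemma normD_pow_le (x y : R) : `|x + y| ^+ p.+1 <= 2 ^+ p.+1 * (`|x| ^+ p.+1 + `|y| ^+ p.+1).
Proof.
wlog xy : x y / `|x| <= `|y|.
  by have [?|/ltW ?] := leP `|x| `|y|; [|rewrite addrC [X in _ * X]addrC]; apply.
have : `|x + y| <= 2 * `|y| by rewrite (le_trans (ler_normD _ _))//; lra.
move=> H; apply: (@le_trans _ _ ((2 * `|y|) ^+ p.+1)).
  by rewrite lerXn2r// nnegrE// mulr_ge0.
by rewrite exprMn ler_pM2l ?exprn_gt0// lerDr exprn_ge0.
Qed.

Lemma pow_integrableD h k : pow_integrable h -> pow_integrable k ->
  pow_integrable (fun x => h x + k x).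
Proof.
move=> [mh Ih] [mk Ik]; have mhk : measurable_fun U (fun x => h x + k x) by exact: measurable_funD.
split => //; have := integrableZl mU (2 ^+ p.+1) (integrableD mU Ih Ik).
apply: le_integrable => //; first by apply/measurable_EFinP; exact: measurable_pow.
move=> x _; rewrite /= lee_fin normrX normr_id (le_trans (normD_pow_le _ _))//.
exact: ler_norm.
Qed.

Lemma pow_integrableZ (c : R) h : pow_integrable h -> pow_integrable (fun x => c * h x).
Proof.
move=> [mh Ih]; split; first exact: measurable_funM.
have := integrableZl mU (`|c| ^+ p.+1) Ih; apply: eq_integrable => // x _ /=.
by rewrite normrM exprMn EFinM.
Qed.

Lemma pow_integrable_norm h : pow_integrable h -> pow_integrable (fun x => `|h x|).
Proof.
move=> [mh Ih]; split; first exact: measurableT_comp.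
by apply: eq_integrable Ih => // x _ /=; rewrite normr_id.
Qed.

Lemma pow_integrable0 : pow_integrable (fun=> 0).
Proof.
split; first exact: measurable_cst.
apply: (eq_integrable mU (cst 0)); last exact: integrable0.
by move=> x _; rewrite /= normr0 expr0n.
Qed.

Lemma pow_integrable_sum n (h : 'I_n -> T -> R) : (forall i, pow_integrable (h i)) ->
  pow_integrable (fun x => \sum_i h i x).
Proof.
move=> Ih; elim: (index_enum _) => [|i s IH].
  have -> : (fun x => \sum_(j <- [::]) h j x) = fun=> 0.
    by apply/funext => x; rewrite big_nil.
  exact: pow_integrable0.
have -> : (fun x => \sum_(j <- i :: s) h j x) = (fun x => h i x + \sum_(j <- s) h j x).
  by apply/funext => x; rewrite big_cons.
exact: pow_integrableD.
Qed.

(** The left side is at most max(x, y)^(p+1): an elementary Young inequality, enough for the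
    integrability of products. *)
Lemma pow_mul_le (x y : R) : 0 <= x -> 0 <= y -> x ^+ p * y <= x ^+ p.+1 + y ^+ p.+1.
Proof.
move=> x0 y0; have [xy|yx] := leP x y.
  apply: ler_wpDl; first exact: exprn_ge0.
  by rewrite exprSr ler_wpM2r// lerXn2r// nnegrE.
apply: ler_wpDr; first exact: exprn_ge0.
by rewrite exprSr ler_wpM2l ?exprn_ge0// ltW.
Qed.

Lemma pow_integrable_mul (g h k : T -> R) (c : R) : measurable_fun U g ->
  pow_integrable h -> pow_integrable k -> (forall x, 0 <= h x) ->
  (forall x, `|g x| <= h x ^+ p * c) -> nu.-integrable U (EFin \o (fun x => g x * k x)).
Proof.
move=> mg [mh Ih] [mk Ik] h0 gh.
have := integrableZl mU `|c| (integrableD mU Ih Ik).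
apply: le_integrable => //; first by apply/measurable_EFinP; exact: measurable_funM.
move=> x _; rewrite /= lee_fin normrM (ger0_norm (h0 x)).
rewrite (le_trans _ (ler_norm _))//.
apply: (@le_trans _ _ ((h x ^+ p * `|c|) * `|k x|)).
  rewrite ler_wpM2r// (le_trans (gh x))// ler_wpM2l ?exprn_ge0//.
  exact: ler_norm.
by rewrite mulrAC mulrC ler_wpM2l// pow_mul_le.
Qed.

End power_integrable.

Unset Implicit Arguments.

Theorem theorem3p2 (R : realType) (N : nat) (hN : (2 <= N)%N)
    (F : 'rV[R]_N -> R)
    (F_ge0 : forall xi, 0 <= F xi)
    (F_convex : convex_function [set: 'rV[R]_N] F)
    (F_C2 : Ck_on 2 [set xi : 'rV[R]_N | xi != 0] F)
    (F_homogeneous : forall (t : R) xi, F (t *: xi) = `|t| * F xi)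
    (F_gt0 : forall xi, xi != 0 -> 0 < F xi)
    (F_hessian : forall xi, xi != 0 ->
       positive_definite (hessian (fun eta => F eta ^+ 2) xi))
    (Omega : set 'rV[R]_N) (Omega_domain : domain Omega)
    (Omega_bounded : bounded_set Omega)
    (u v : 'rV[R]_N -> R) (Du Dv : 'rV[R]_N -> 'rV[R]_N)
    (u_W1N : W1p N Omega u Du) (v_W1N : W1p N Omega v Dv)
    (le_QN : le_opp_QN F Omega Du Dv)
    (le_bdry : le_boundary N Omega u v) :
  {ae lebesgue_rV R N, forall x, Omega x -> u x <= v x}.
Proof.
(* Write N = p + 1: slicing needs a dimension of the form m + 1, and p is then the growth exponent
   of the flux. *)
case: N hN F F_ge0 F_convex F_C2 F_homogeneous F_gt0 F_hessian Omega
  Omega_domain Omega_bounded u v Du Dv u_W1N v_W1N le_QN le_bdry => [//|p] hN F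
  F_ge0 F_convex F_C2 F_homogeneous F_gt0 F_hessian Omega Omega_domain
  Omega_bounded u v Du Dv u_W1N v_W1N le_QN le_bdry.
set mu := lebesgue_rV R p.+1.
have [oU _ _] := Omega_domain; have mU := rV_open_measurable oU.
have Ufin := bounded_lebesgue_rV_lty oU Omega_bounded.
pose w x := Num.max (u x - v x) 0.
have [Dw w_W0] := le_bdry; rewrite -/w in w_W0; have [w_W1N _] := w_W0.
have [[mu_ iu] iDu weak_u] := u_W1N.
have [[mv iv] iDv weak_v] := v_W1N.
have [[mw iw] iDw weak_w] := w_W1N.
have Iu := integrable_of_pow (ltn0Sn p) mU Ufin mu_ iu.
have Iv := integrable_of_pow (ltn0Sn p) mU Ufin mv iv.
have Iw := integrable_of_pow (ltn0Sn p) mU Ufin mw iw.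
have IDu i := integrable_of_pow (ltn0Sn p) mU Ufin (iDu i).1 (iDu i).2.
have IDv i := integrable_of_pow (ltn0Sn p) mU Ufin (iDv i).1 (iDv i).2.
have IDw i := integrable_of_pow (ltn0Sn p) mU Ufin (iDw i).1 (iDw i).2.
have w0 x : 0 <= w x by rewrite le_max lexx orbT.
have Dw0 i : {ae mu, forall x, Omega x -> w x = 0 -> Dw x ord0 i = 0}.
  apply: (ae_partial_eq0 (i := i) oU Iw (IDw i)) => // phi; exact: weak_w.
have Dw1 i : {ae mu, forall x, Omega x -> w x - (u x - v x) = 0 ->
    Dw x ord0 i - (Du x ord0 i - Dv x ord0 i) = 0}.
  have Iuv : mu.-integrable Omega (EFin \o (fun x => u x - v x)) := integrableB mU Iu Iv.
  have IDuv : mu.-integrable Omega (EFin \o (fun x => Du x ord0 i - Dv x ord0 i)) :=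
    integrableB mU (IDu i) (IDv i).
  apply: (ae_partial_eq0 (i := i) oU (integrableB mU Iw Iuv) (integrableB mU (IDw i) IDuv)).
    by move=> x _; rewrite subr_ge0 le_max lexx.
  apply: weak_partialB => // phi Cphi; first exact: weak_w.
  apply: (weak_partialB oU Iu Iv (IDu i) (IDv i)) => // psi Cpsi; first exact: weak_u.
  exact: weak_v.
have Dw_ae : {ae mu, forall x, Omega x -> Dw x = if u x <= v x then 0 else Du x - Dv x}.
  (* Almost everywhere commutes with a countable conjunction; coordinates are reached from naturals
     through [inord]. *)
  have all_i (P : 'I_p.+1 -> 'rV[R]_p.+1 -> Prop) : (forall i, {ae mu, forall x, P i x}) ->
      {ae mu, forall x, forall i, P i x}.
    move=> aeP; have : {ae mu, forall x, forall n : nat, P (inord n) x}.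
      by apply: ae_foralln => n; exact: aeP.
    by apply: filterS => x Px i; have := Px i; rewrite inord_val.
  apply: filterS2 (all_i _ Dw0) (all_i _ Dw1) => x H0 H1 Ux.
  apply/rowP => i; case: ifPn => uv.
    by rewrite mxE H0// /w max_r// subr_le0.
  rewrite !mxE; apply/eqP; rewrite -subr_eq0; apply/eqP/H1 => //.
  by rewrite /w max_l ?subrr// subr_ge0 ltW// ltNge.
pose E x := dot (QN_flux F (Du x) - QN_flux F (Dv x)) (Dw x).
have flux_monotone := QN_flux_monotone F_convex F_C2 F_homogeneous F_gt0 F_hessian.
(* Without integrability the sign of the real-valued integral would carry no information, since
   [fine] sends an infinite integral to 0. *)
have IE : mu.-integrable Omega (EFin \o E).
  have powD (D : 'rV[R]_p.+1 -> 'rV[R]_p.+1) :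
      (forall i, in_Lp p.+1 Omega (fun x => D x ord0 i)) ->
      forall i, pow_integrable mu Omega p (fun x => D x ord0 i).
    by move=> iD i; have [mD finD] := iD i; exact: pow_integrableP.
  have Iflux (D : 'rV[R]_p.+1 -> 'rV[R]_p.+1) i :
      (forall i, in_Lp p.+1 Omega (fun x => D x ord0 i)) ->
      mu.-integrable Omega (EFin \o (fun x => QN_flux F (D x) ord0 i * Dw x ord0 i)).
    move=> iD; apply: (@pow_integrable_mul _ _ _ mu Omega p mU _
      (fun x => \sum_k `|D x ord0 k| * F (delta_mx ord0 k)) _ (F (delta_mx ord0 i))).
    - have mq := measurable_QN_flux F_C2 i.
      apply: (@measurable_fun_comp_rV _ _ _ _ (fun xi => QN_flux F xi ord0 i) D Omega mU mq) => j.
      by have [] := iD j.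
    - apply: pow_integrable_sum => // k.
      have := pow_integrableZ mU (F (delta_mx ord0 k)) (pow_integrable_norm mU (powD D iD k)).
      by congr pow_integrable; apply/funext => x; rewrite mulrC.
    - exact: powD.
    - by move=> x; apply: sumr_ge0 => k _; rewrite mulr_ge0.
    - by move=> x; exact: QN_flux_bound.
  pose h (i : 'I_p.+1) x :=
    QN_flux F (Du x) ord0 i * Dw x ord0 i - QN_flux F (Dv x) ord0 i * Dw x ord0 i.
  have Ih i : mu.-integrable Omega (EFin \o h i) :=
    integrableB mU (Iflux Du i iDu) (Iflux Dv i iDv).
  have Isum : mu.-integrable Omega (fun x => \sum_i (EFin \o h i) x)%E.
    by apply: integrable_sum => // i _; exact: Ih.
  apply: eq_integrable Isum => //.
  move=> x _; rewrite /= sumEFin; congr EFin; rewrite /E dotE.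
  by apply: eq_bigr => i _; rewrite !mxE mulrBl.
have E_le0 : \int[mu]_(x in Omega) E x <= 0.
  by apply: le_QN w_W0 _; apply: aeW => x _.
have E_ge0 : {ae mu, forall x, Omega x -> 0 <= E x}.
  apply: filterS Dw_ae => x H Ux; rewrite /E H//; case: ifP => _.
    by rewrite /dot trmx0 mulmx0 mxE.
  by have [] := flux_monotone (Du x) (Dv x) hN.
have E_eq0 : {ae mu, forall x, Omega x -> E x = 0}.
  (* Since E >= 0 a.e., the integral of |E| is that of E, which is at most 0. *)
  have mE := measurable_int _ IE.
  have absE : (\int[mu]_(x in Omega) `|(EFin \o E) x| = 0)%E.
    apply/eqP; rewrite eq_le integral_ge0// andbT.
    rewrite (_ : (\int[mu]_(x in Omega) _ = \int[mu]_(x in Omega) (EFin \o E) x)%E).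
      rewrite -[leLHS]fineK; last exact: integrable_fin_num.
      by rewrite lee_fin.
    apply: ae_eq_integral => //; first exact: measurableT_comp.
    by apply: filterS E_ge0 => x H Ux /=; rewrite ger0_norm// H.
  have /(ae_eq_integral_abs mu mU mE) := absE.
  by apply: filterS => x H Ux; have := H Ux => -[].
(* One coordinate suffices, as the Poincare inequality uses a single direction. Where u > v, E = 0
   and strict monotonicity give Du = Dv. *)
have Dw_eq0 : {ae mu, forall x, Omega x -> Dw x ord0 ord0 = 0}.
  apply: filterS2 E_eq0 Dw_ae => x Ex H Ux; have := Ex Ux; rewrite /E H//.
  case: ifP => _ Ex0; rewrite ?mxE//.
  have [_ /(_ Ex0) ->] := flux_monotone (Du x) (Dv x) hN.
  by rewrite subrr.
apply: filterS (W1p0_partial_eq0 oU Omega_bounded w_W0 Dw_eq0) => x H Ux.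
have : u x - v x <= w x by rewrite le_max lexx.
by rewrite H// subr_le0.
Qed.
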